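(* Recursive isomorphism on $2^\omega$ is a measure universal countable Borel equivalence relation.
   Context: Recursive isomorphism on $2^\omega$ is the orbit equivalence relation of the permutation action $(g\cdot y)(n)=y(g^{-1}(n))$ of the group of computable bijections $g\colon\omega\to\omega$ on $2^\omega$. A countable Borel equivalence relation is a Borel equivalence relation on a standard Borel space all of whose classes are countable. A countable Borel equivalence relation $E$ is measure universal if given any countable Borel equivalence relation $F$ on a standard probability space $(X,\mu)$, there is a Borel $\mu$-conull set $A\subseteq X$ such that $F\restriction A$ is Borel reducible to $E$, i.e. there is a Borel function $f$ on $A$ with $x\mathrel{F}y\iff f(x)\mathrel{E}f(y)$ for all $x,y\in A$. *)

(* Defs.v *)
From mathcomp Require Import all_boot all_order all_algebra.
From mathcomp Require Import all_classical all_reals all_analysis.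

Set Implicit Arguments.
Unset Strict Implicit.
Unset Printing Implicit Defensive.

Local Open Scope classical_set_scope.

(* Kleene's partial recursive functions, as programs of a given arity. *)
Inductive recfun : nat -> Type :=
| RZero n : recfun n
| RSucc : recfun 1
| RProj n (i : 'I_n) : recfun n
| RComp k n (f : recfun k) (g : 'I_k -> recfun n) : recfun n
| RPrec n (f : recfun n) (g : recfun n.+2) : recfun n.+1
| RMin n (f : recfun n.+1) : recfun n.

(* [reval f v y]: the program f converges on input v, with output y.
   For RPrec, s is the sequence of values
     s 0 = f(v'), s (m+1) = g(m, s m, v'), where v = (a, v') and y = s a;
   for RMin, y is the least zero of f(-, v), all the earlier values of which
   must be defined. *)
Fixpoint reval n (f : recfun n) : n.-tuple nat -> nat -> Prop :=
  match f in recfun n return n.-tuple nat -> nat -> Prop with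
  | RZero _ => fun _ y => y = 0%N
  | RSucc => fun v y => y = (thead v).+1
  | RProj _ i => fun v y => y = tnth v i
  | RComp k _ f g => fun v y =>
      exists w : k.-tuple nat,
        (forall i, reval (g i) v (tnth w i)) /\ reval f w y
  | RPrec _ f g => fun v y =>
      let v' := [tuple of behead v] in
      exists s : nat -> nat,
        [/\ reval f v' (s 0%N),
            forall m, (m < thead v)%N ->
              reval g [tuple of m :: s m :: v'] (s m.+1) &
            y = s (thead v)]
  | RMin _ f => fun v y =>
      reval f [tuple of y :: v] 0%N /\
      forall m, (m < y)%N -> exists z, reval f [tuple of m :: v] z.+1
  end.

Definition computable (f : nat -> nat) : Prop :=
  exists c : recfun 1, forall n, reval c [tuple n] (f n).

(* The inverse of a computable bijection is automatically computable. *)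
Record computable_bij := ComputableBij {
  cbij :> nat -> nat;
  cbij_inv : nat -> nat;
  cbijK : cancel cbij cbij_inv;
  cbij_invK : cancel cbij_inv cbij;
  cbij_computable : computable cbij }.

Definition borel (T : ptopologicalType) := g_sigma_algebraType (@open T).

Definition perm_act (g : computable_bij) (y : borel cantor_space) :
    borel cantor_space :=
  fun n => y (cbij_inv g n).

Definition rec_iso (x y : borel cantor_space) : Prop :=
  exists g : computable_bij, perm_act g x = y.

(* The Hausdorff condition turns the complete pseudometric into a metric. *)
Definition polish (R : realType) (U : completePseudoMetricType R) : Prop :=
  hausdorff_space U /\ exists2 D : set U, countable D & dense D.

Definition standard_borel (R : realType) d (T : measurableType d) : Prop :=
  exists (U : completePseudoMetricType R) (f : T -> borel U) (g : borel U -> T),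
    [/\ polish U, measurable_fun setT f, measurable_fun setT g,
        cancel f g & cancel g f].

Definition countable_borel_equivalence (R : realType) d (T : measurableType d)
    (E : T -> T -> Prop) : Prop :=
  [/\ standard_borel R T,
      RelationClasses.Equivalence E,
      measurable [set p : T * T | E p.1 p.2] &
      forall x, countable [set y | E x y]].

Definition borel_reducible_on d1 d2 (X : measurableType d1)
    (Y : measurableType d2) (A : set X) (F : X -> X -> Prop)
    (E : Y -> Y -> Prop) : Prop :=
  exists f : X -> Y, measurable_fun A f /\
    forall x y, A x -> A y -> (F x y <-> E (f x) (f y)).

Definition measure_universal (R : realType) d (Y : measurableType d)
    (E : Y -> Y -> Prop) : Prop :=
  forall (d' : measure_display) (X : measurableType d') (mu : probability X R)
    (F : X -> X -> Prop),
    countable_borel_equivalence R F ->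
    exists A : set X,
      [/\ measurable A, mu (~` A) = 0%E & borel_reducible_on A F E].

(* Main.v *)
Require Import Defs.
From HB Require Import structures.
From mathcomp Require Import all_boot all_order all_algebra.
From mathcomp Require Import all_classical all_reals all_analysis.
From mathcomp Require Import zify lra.

(** Both directions of the reduction come from one family of Borel sets. Let F
    be a countable Borel equivalence relation on a standard probability space.
    Off a null set, F is the union of the graphs of Borel involutions [sig m]
    of X (measured Lusin-Novikov and Feldman-Moore). Natural numbers code words
    in the letters m followed by an end marker, the n-th odd number being the
    empty word with marker n, in such a way that prepending or cancelling a
    letter m is a computable involution of nat. If w is a word with marker n,
    put f(x)(w) = 1 iff the point that the word w leads to from x, along the
    involutions, lies in C_n. Then F-related points have recursively isomorphic
    images, for any sets C_n.

    Conversely, if the i-th computable permutation maps f(x) to f(y), then for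
    all n the bit C_n(y) equals C_(m i n)(p i n x), with p i n x in the F-class
    of x. The C_n are chosen by diagonalisation so that, for almost every x,
    this forces y = p i n x for some n. If m i n <> n for infinitely many n,
    or if p i n x is not eventually constant in n, the equations are made
    inconsistent: in the second case the same set is used for a long block of
    indices n, chosen to separate two of the points p i n x of the block for a
    fixed proportion of the remaining x. Otherwise p i n x is eventually a
    constant, which equals y because every coordinate of the points of X is
    used as C_n for infinitely many n. *)

Set Implicit Arguments.
Unset Strict Implicit.
Unset Printing Implicit Defensive.

Import Order.TTheory GRing.Theory Num.Theory numFieldNormedType.Exports.
Local Open Scope classical_set_scope.

(** * Computable functions *)

Lemma reval_functional n (c : recfun n) v y z :
  reval c v y -> reval c v z -> y = z.
Proof.
elim: c v y z => {n} [n|| n i|k n f IHf g IHg|n f IHf g IHg|n f IHf] v y z /=.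
- by move=> -> ->.
- by move=> -> ->.
- by move=> -> ->.
- move=> [w [gw fy]] [w' [gw' fz]].
  suff ww' : w = w' by apply: IHf fy _; rewrite ww'.
  by apply: eq_from_tnth => i; exact: IHg (gw i) (gw' i).
- move=> [s [s0 sS ->]] [s' [s'0 s'S ->]].
  suff H m : (m <= thead v)%N -> s m = s' m by exact: H.
  elim: m => [_|m IH mv]; first exact: IHf s0 s'0.
  have := s'S m mv; rewrite -IH; last exact: ltnW.
  exact: IHg (sS m mv).
- move=> [y0 ym] [z0 zm].
  case: (ltngtP y z) => // [/zm|/ym] [t ft].
    by have := IHf _ _ _ ft y0.
  by have := IHf _ _ _ ft z0.
Qed.

(** * Numbering the programs and the computable bijections *)

Fixpoint recfun_code n (c : recfun n) : GenTree.tree nat :=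
  match c with
  | RZero _ => GenTree.Node 0 [::]
  | RSucc => GenTree.Node 1 [::]
  | RProj n i => GenTree.Node 2 [:: GenTree.Leaf (nat_of_ord i)]
  | RComp k n f g => GenTree.Node 3
     (GenTree.Leaf k :: recfun_code f :: [seq recfun_code (g i) | i <- enum 'I_k])
  | RPrec n f g => GenTree.Node 4 [:: recfun_code f; recfun_code g]
  | RMin n f => GenTree.Node 5 [:: recfun_code f]
  end.

Lemma existT_recfun_inj n (x y : recfun n) :
  existT recfun n x = existT recfun n y -> x = y.
Proof. exact: Eqdep_dec.inj_pair2_eq_dec PeanoNat.Nat.eq_dec recfun n x y. Qed.

(** The code omits the arity [n], hence the hypothesis [n = m]. Two separate indices let the
    induction enter a composition, whose inner arity [k] is read off the code. *)
Lemma recfun_code_inj_dep n (c : recfun n) m (c' : recfun m) :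
  n = m -> recfun_code c = recfun_code c' -> existT recfun n c = existT recfun m c'.
Proof.
elim: c m c' => {n} [n|| n i|k n f IHf g IHg|n f IHf g IHg|n f IHf] m [] //=.
- by move=> ? ->.
- move=> n' i' e; subst n' => -[] ii'; congr existT; congr RProj; exact: val_inj.
- move=> k' n' f' g' e; subst n' => -[] e; subst k' => /(IHf _ _ erefl)/existT_recfun_inj ->.
  move=> H; congr existT; congr RComp; apply: funext => i.
  apply: existT_recfun_inj; apply: IHg => //.
  move: H => /eq_in_map; apply; exact: mem_enum.
- move=> n' f' g' [] e; subst n' => -[] /(IHf _ _ erefl)/existT_recfun_inj ->.
  by move=> /(IHg _ _ erefl)/existT_recfun_inj ->.
- move=> n' f' e; subst n' => -[] /(IHf _ _ erefl)/existT_recfun_inj ->.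
  by [].
Qed.

Lemma recfun_code_inj n : injective (@recfun_code n).
Proof. by move=> c c' /(recfun_code_inj_dep erefl)/existT_recfun_inj. Qed.

(** Let [h i] be the inverse of some bijection computed by the program of code i, and the identity
    if there is none. A program determines its function, hence also the inverse. *)
Lemma computable_bij_enum :
  exists h : nat -> nat -> nat, forall g : computable_bij,
    exists i, cbij_inv g = h i.
Proof.
pose P i (g : computable_bij) := exists c : recfun 1,
  (forall n, reval c [tuple n] (g n)) /\ pickle (recfun_code c) = i.
pose h i := if pselect (exists g, P i g) is left e then cbij_inv (projT1 (cid e)) else id.
exists h => g; have [c cg] := cbij_computable g.
exists (pickle (recfun_code c)); rewrite /h; case: pselect => [e|]; last first.
  by case; exists g, c.
case: (cid e) => /= g' [c' [c'g' /(pcan_inj pickleK)/recfun_code_inj ?]]; subst c'.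
apply: funext => n; have gg' : g (cbij_inv g' n) = g' (cbij_inv g' n).
  exact: reval_functional (cg _) (c'g' _).
by rewrite cbij_invK in gg'; rewrite -[in LHS]gg' cbijK.
Qed.

(** * Closure properties of total computable functions of several variables *)

Definition tcomputable n (f : n.-tuple nat -> nat) :=
  exists c : recfun n, forall v, reval c v (f v).

Lemma tcomputable_ext n (f g : n.-tuple nat -> nat) :
  f =1 g -> tcomputable f -> tcomputable g.
Proof. by move=> fg [c cf]; exists c => v; rewrite -fg. Qed.

Lemma tcomputable_tnth n (i : 'I_n) : tcomputable (fun v => tnth v i).
Proof. by exists (RProj i). Qed.

Lemma tcomputable_comp k n (f : k.-tuple nat -> nat)
    (g : 'I_k -> n.-tuple nat -> nat) :
  tcomputable f -> (forall i, tcomputable (g i)) ->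
  tcomputable (fun v => f [tuple g i v | i < k]).
Proof.
move=> [cf cfP] /choice[cg cgP]; exists (RComp cf cg) => v /=.
by exists [tuple g i v | i < k]; split=> // i; rewrite tnth_mktuple; exact: cgP.
Qed.

Lemma tcomputable_prec n (f : n.-tuple nat -> nat) (g : n.+2.-tuple nat -> nat)
    (h : n.+1.-tuple nat -> nat) :
  tcomputable f -> tcomputable g ->
  (forall v : n.-tuple nat, h [tuple of 0 :: v] = f v) ->
  (forall m (v : n.-tuple nat),
    h [tuple of m.+1 :: v] = g [tuple of m :: h [tuple of m :: v] :: v]) ->
  tcomputable h.
Proof.
move=> [cf cfP] [cg cgP] h0 hS; exists (RPrec cf cg) => v /=.
case/tupleP: v => m v.
exists (fun m => h [tuple of m :: v]); split.
- by rewrite (_ : [tuple of _] = v) ?h0//; exact: val_inj.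
- move=> a _; rewrite hS (_ : [tuple of _] = [tuple of a :: h [tuple of a :: v] :: v])//.
  exact: val_inj.
- by rewrite theadE.
Qed.

Lemma tcomputable_min n (f : n.+1.-tuple nat -> nat) (h : n.-tuple nat -> nat) :
  tcomputable f ->
  (forall v : n.-tuple nat, f [tuple of h v :: v] = 0) ->
  (forall (v : n.-tuple nat) m, m < h v -> 0 < f [tuple of m :: v]) -> tcomputable h.
Proof.
move=> [cf cfP] h0 hm; exists (RMin cf) => v /=; split.
  by rewrite -(h0 v).
move=> m /hm f_gt0; exists (f [tuple of m :: v]).-1.
by rewrite prednK//; exact: cfP.
Qed.

Lemma tcomputable_succ n (f : n.-tuple nat -> nat) :
  tcomputable f -> tcomputable (fun v => (f v).+1).
Proof.
move=> cf; have cS : tcomputable (fun v : 1.-tuple nat => (thead v).+1).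
  by exists RSucc.
by apply: tcomputable_ext (tcomputable_comp cS (fun=> cf)) => v; rewrite /thead tnth_mktuple.
Qed.

Lemma tcomputable_cst n k : tcomputable (fun _ : n.-tuple nat => k).
Proof.
elim: k => [|k IH]; first by exists (RZero n).
exact: tcomputable_succ IH.
Qed.

Definition computable2 (op : nat -> nat -> nat) :=
  tcomputable (fun v : 2.-tuple nat => op (thead v) (tnth v (inord 1))).

Lemma tcomputable_comp2 n op (f g : n.-tuple nat -> nat) :
  computable2 op -> tcomputable f -> tcomputable g ->
  tcomputable (fun v => op (f v) (g v)).
Proof.
move=> cop cf cg.
have := tcomputable_comp (g := fun i : 'I_2 => if i == ord0 then f else g) cop.
move=> /(_ (fun i => ltac:(by case: ifP)))/tcomputable_ext; apply => v /=.
rewrite /thead !tnth_mktuple; congr op; case: ifP => //.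
by move=> /eqP/(congr1 val); rewrite /= inordK.
Qed.

Lemma computable2_prec (op : nat -> nat -> nat) (g : 3.-tuple nat -> nat)
    (f : 1.-tuple nat -> nat) : tcomputable f -> tcomputable g ->
  (forall y, op 0 y = f [tuple y]) ->
  (forall m y, op m.+1 y = g [tuple m; op m y; y]) -> computable2 op.
Proof.
have E m (v : 1.-tuple nat) : tnth [tuple of m :: v] (inord 1) = thead v.
  by rewrite /thead !(tnth_nth 0) inordK.
move=> cf cg op0 opS; apply: (tcomputable_prec cf cg) => [v|m v].
  rewrite E theadE op0; congr f; apply: val_inj.
  by case/tupleP: v => y v; rewrite theadE (tuple0 v).
rewrite !E !theadE opS; congr g; apply: val_inj => /=.
by case/tupleP: v => y v; rewrite theadE (tuple0 v).
Qed.

Lemma computable2_swap op : computable2 op -> computable2 (fun x y => op y x).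
Proof.
move=> cop; apply: (tcomputable_comp2 cop); exact: tcomputable_tnth.
Qed.

Lemma computable2_add : computable2 addn.
Proof.
apply: (computable2_prec (f := fun v => tnth v ord0)
  (g := fun v => (tnth v (inord 1)).+1)).
- exact: tcomputable_tnth.
- by apply: tcomputable_succ; exact: tcomputable_tnth.
- by [].
- by move=> m y; rewrite (tnth_nth 0) inordK.
Qed.

Lemma computable2_mul : computable2 muln.
Proof.
apply: (computable2_prec (f := fun v => 0)
  (g := fun v => tnth v (inord 1) + tnth v (inord 2))).
- exact: tcomputable_cst.
- by apply: tcomputable_comp2; [exact: computable2_add|exact: tcomputable_tnth..].
- by [].
- by move=> m y; rewrite !(tnth_nth 0) !inordK//= mulSn addnC.
Qed.

Lemma tcomputable_pred n (f : n.-tuple nat -> nat) :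
  tcomputable f -> tcomputable (fun v => (f v).-1).
Proof.
move=> cf; have cP : computable2 (fun x _ => x.-1).
  apply: (computable2_prec (f := fun=> 0) (g := fun v => tnth v ord0)) => //.
  - exact: tcomputable_cst.
  - exact: tcomputable_tnth.
exact: (tcomputable_comp2 cP cf cf).
Qed.

Lemma computable2_sub : computable2 subn.
Proof.
apply: (@computable2_swap (fun y x => x - y)).
apply: (computable2_prec (f := fun v => tnth v ord0)
  (g := fun v => (tnth v (inord 1)).-1)).
- exact: tcomputable_tnth.
- by apply: tcomputable_pred; exact: tcomputable_tnth.
- by move=> y; rewrite subn0.
- by move=> m y; rewrite (tnth_nth 0) inordK//= subnS.
Qed.

Section tcomputable_arithmetic.
Variables (n : nat) (f g : n.-tuple nat -> nat).
Hypotheses (cf : tcomputable f) (cg : tcomputable g).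

Lemma tcomputable_add : tcomputable (fun v => f v + g v).
Proof. exact: tcomputable_comp2 computable2_add cf cg. Qed.

Lemma tcomputable_mul : tcomputable (fun v => f v * g v).
Proof. exact: tcomputable_comp2 computable2_mul cf cg. Qed.

Lemma tcomputable_sub : tcomputable (fun v => f v - g v).
Proof. exact: tcomputable_comp2 computable2_sub cf cg. Qed.

End tcomputable_arithmetic.

Lemma tcomputable_leq n (f g : n.-tuple nat -> nat) :
  tcomputable f -> tcomputable g -> tcomputable (fun v => f v <= g v : nat).
Proof.
move=> cf cg; apply: tcomputable_ext (tcomputable_sub (tcomputable_cst n 1)
  (tcomputable_sub cf cg)) => v; lia.
Qed.

Lemma tcomputable_eqn n (f g : n.-tuple nat -> nat) :
  tcomputable f -> tcomputable g -> tcomputable (fun v => f v == g v : nat).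
Proof.
move=> cf cg; apply: tcomputable_ext (tcomputable_mul (tcomputable_leq cf cg)
  (tcomputable_leq cg cf)) => v; lia.
Qed.

Lemma tcomputable_if n (p : n.-tuple nat -> bool) (f g : n.-tuple nat -> nat) :
  tcomputable (fun v => p v : nat) -> tcomputable f -> tcomputable g ->
  tcomputable (fun v => if p v then f v else g v).
Proof.
move=> cp cf cg; apply: tcomputable_ext (tcomputable_add (tcomputable_mul cp cf)
  (tcomputable_mul (tcomputable_sub (tcomputable_cst n 1) cp) cg)) => v.
by case: (p v); rewrite ?mul1n ?mul0n ?addn0.
Qed.

(** The quotient is the least q with f v < d (q + 1), that is, the least zero of the truncated
    difference [F]. *)
Lemma tcomputable_divn n (f : n.-tuple nat -> nat) d :
  0 < d -> tcomputable f -> tcomputable (fun v => f v %/ d).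
Proof.
move=> d_gt0 [c cfP]; pose F (v : n.+1.-tuple nat) :=
  (f [tuple of behead v]).+1 - d * (thead v).+1.
have cF : tcomputable F.
  apply: tcomputable_sub.
    apply: tcomputable_succ; have := tcomputable_comp (ex_intro _ c cfP)
      (fun i : 'I_n => tcomputable_tnth (lift ord0 i)).
    apply: tcomputable_ext => v; congr f; apply: eq_from_tnth => i.
    by rewrite tnth_mktuple tnth_behead; congr tnth; apply: val_inj; rewrite /= inordK// ltnS.
  apply: tcomputable_mul; first exact: tcomputable_cst.
  by apply: tcomputable_succ; exact: tcomputable_tnth.
apply: (tcomputable_min cF) => [v|v m]; rewrite /F theadE.
  have -> : [tuple of behead [tuple of f v %/ d :: v]] = v by exact: val_inj.
  have := divn_eq (f v) d; have := ltn_mod (f v) d; rewrite d_gt0; nia.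
have -> : [tuple of behead [tuple of m :: v]] = v by exact: val_inj.
have := leq_trunc_div (f v) d; nia.
Qed.

Lemma tcomputable_modn n (f : n.-tuple nat -> nat) d :
  0 < d -> tcomputable f -> tcomputable (fun v => f v %% d).
Proof.
move=> d_gt0 cf; apply: tcomputable_ext (tcomputable_sub cf (tcomputable_mul
  (tcomputable_divn d_gt0 cf) (tcomputable_cst n d))) => v.
by rewrite [in X in X - _](divn_eq (f v) d) addKn.
Qed.

Lemma computableP (f : nat -> nat) :
  computable f <-> tcomputable (fun v : 1.-tuple nat => f (thead v)).
Proof.
split=> -[c cP]; exists c.
  by move=> v; case/tupleP: v => n v; rewrite (tuple0 v) theadE; exact: cP.
by move=> n; exact: (cP [tuple n]).
Qed.

Lemma computable_id : computable id.
Proof. by apply/computableP; exact: tcomputable_tnth. Qed.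

Lemma computable_comp f g : computable f -> computable g -> computable (f \o g).
Proof.
move=> /computableP cf /computableP cg; apply/computableP.
by apply: tcomputable_ext (tcomputable_comp cf (fun=> cg)) => v; rewrite /thead tnth_mktuple.
Qed.

(** Unbounded search for the preimage: it is the first, and only, zero of [F]. *)
Lemma cbij_inv_computable (g : computable_bij) : computable (cbij_inv g).
Proof.
have /computableP cg := cbij_computable g; apply/computableP.
pose F (v : 2.-tuple nat) := 1 - (g (thead v) == tnth v (inord 1)).
apply: (@tcomputable_min _ F).
- apply: tcomputable_sub; first exact: tcomputable_cst.
  apply: tcomputable_eqn; last exact: tcomputable_tnth.
  have := tcomputable_comp cg (fun i : 'I_1 => tcomputable_tnth (@ord0 1)).
  by apply: tcomputable_ext => v; rewrite /thead tnth_mktuple.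
- move=> v; rewrite /F theadE cbij_invK (tnth_nth 0) inordK//=.
  by case/tupleP: v => n v; rewrite theadE eqxx.
- move=> v m; rewrite /F theadE (tnth_nth 0) inordK//=.
  case/tupleP: v => n v; rewrite theadE /=.
  by case: eqP => // <-; rewrite cbijK ltnn.
Qed.

(** * Coding words by natural numbers *)

(** The condition says that w has 2-adic valuation m + 1. So a number starts with at most one
    letter, and odd numbers start with none. *)
Definition starts m w := w %% 2 ^ m.+2 == 2 ^ m.+1.

(* The words starting with m are the numbers 2 ^ m.+1 modulo 2 ^ m.+2. The other
   numbers are listed onto them in increasing order, so only reduced words (no
   letter twice in a row) have a code. *)
Definition prepend m w :=
  2 ^ m.+2 * ((2 ^ m.+2).-1 * (w %/ 2 ^ m.+2) + unbump (2 ^ m.+1) (w %% 2 ^ m.+2))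
  + 2 ^ m.+1.

(** Inverse to [prepend m]: the rank w %/ 2^(m+2) of w among the numbers starting with m is turned
    into the number of that rank among the others, [bump] jumping over the excluded residue. *)
Definition behead_word m w :=
  2 ^ m.+2 * (w %/ 2 ^ m.+2 %/ (2 ^ m.+2).-1)
  + bump (2 ^ m.+1) (w %/ 2 ^ m.+2 %% (2 ^ m.+2).-1).

Definition flip m w := if starts m w then behead_word m w else prepend m w.

Lemma divmodnMD d q r : r < d -> (d * q + r) %/ d = q /\ (d * q + r) %% d = r.
Proof.
by move=> rd; rewrite mulnC divnMDl ?modnMDl ?modn_small ?divn_small ?addn0//; lia.
Qed.

Lemma expn2_bounds m : 2 ^ m.+2 = (2 ^ m.+1).*2 /\ 1 < 2 ^ m.+1.
Proof.
split; first by rewrite expnS mul2n.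
by rewrite -{1}(expn0 2) ltn_exp2l.
Qed.

Lemma starts_prepend m w : starts m (prepend m w).
Proof.
have [? ?] := expn2_bounds m; rewrite /starts /prepend.
by have [_ ->] := @divmodnMD (2 ^ m.+2) ((2 ^ m.+2).-1 * (w %/ 2 ^ m.+2) +
  unbump (2 ^ m.+1) (w %% 2 ^ m.+2)) (2 ^ m.+1) ltac:(lia).
Qed.

Lemma prependK m w : ~~ starts m w -> behead_word m (prepend m w) = w.
Proof.
have [eA B1] := expn2_bounds m; rewrite /starts /behead_word /prepend => wB.
have [-> _] := @divmodnMD (2 ^ m.+2) ((2 ^ m.+2).-1 * (w %/ 2 ^ m.+2) +
  unbump (2 ^ m.+1) (w %% 2 ^ m.+2)) (2 ^ m.+1) ltac:(lia).
have wA : w %% 2 ^ m.+2 < 2 ^ m.+2 by rewrite ltn_mod; lia.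
have [-> ->] := @divmodnMD (2 ^ m.+2).-1 (w %/ 2 ^ m.+2)
   (unbump (2 ^ m.+1) (w %% 2 ^ m.+2)) ltac:(rewrite /unbump; lia).
by rewrite unbumpK// mulnC -divn_eq.
Qed.

Lemma behead_word_starts m w : ~~ starts m (behead_word m w).
Proof.
have [eA B1] := expn2_bounds m; rewrite /starts /behead_word.
have H : w %/ 2 ^ m.+2 %% (2 ^ m.+2).-1 < (2 ^ m.+2).-1 by rewrite ltn_mod; lia.
have [_ ->] := @divmodnMD (2 ^ m.+2) (w %/ 2 ^ m.+2 %/ (2 ^ m.+2).-1)
  (bump (2 ^ m.+1) (w %/ 2 ^ m.+2 %% (2 ^ m.+2).-1)) ltac:(rewrite /bump; lia).
by rewrite eq_sym neq_bump.
Qed.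

Lemma behead_wordK m w : starts m w -> prepend m (behead_word m w) = w.
Proof.
have [eA B1] := expn2_bounds m; rewrite /starts /behead_word /prepend => /eqP wB.
have H : w %/ 2 ^ m.+2 %% (2 ^ m.+2).-1 < (2 ^ m.+2).-1 by rewrite ltn_mod; lia.
have [-> ->] := @divmodnMD (2 ^ m.+2) (w %/ 2 ^ m.+2 %/ (2 ^ m.+2).-1)
  (bump (2 ^ m.+1) (w %/ 2 ^ m.+2 %% (2 ^ m.+2).-1)) ltac:(rewrite /bump; lia).
rewrite bumpK [_.-1 * _]mulnC -divn_eq.
by rewrite -[in X in _ + X]wB mulnC -divn_eq.
Qed.

(** This makes the removal of letters terminate. *)
Lemma ltn_behead_word m w : starts m w -> behead_word m w < w.
Proof.
have [eA B1] := expn2_bounds m; rewrite /starts /behead_word => /eqP wB.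
rewrite {3}(divn_eq w (2 ^ m.+2)) wB.
set q := w %/ 2 ^ m.+2.
have := leq_trunc_div q (2 ^ m.+2).-1.
have := divn_eq q (2 ^ m.+2).-1; have := ltn_pmod q (d := (2 ^ m.+2).-1) ltac:(lia).
rewrite /bump; set a := q %/ _; set b := q %% _ => bA qE _.
by case: leqP => /=; nia.
Qed.

Lemma starts_logn m w : starts m w -> logn 2 w = m.+1.
Proof.
rewrite /starts => /eqP wB; rewrite (divn_eq w (2 ^ m.+2)) wB.
rewrite expnS mulnA -[X in _ + X]mul1n -mulnDl lognM ?addn_gt0 ?orbT ?expn_gt0//.
by rewrite pfactorK// logn_coprime// coprime2n addn1 /= oddM andbF.
Qed.

Lemma starts_inj m m' w : starts m w -> starts m' w -> m = m'.
Proof. by move=> /starts_logn e /starts_logn; rewrite e => -[]. Qed.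

Lemma starts_odd m w : odd w -> ~~ starts m w.
Proof.
move=> ow; apply/negP => /starts_logn; rewrite logn_coprime//.
by rewrite coprime2n.
Qed.

Lemma flipK m : involutive (flip m).
Proof.
move=> w; rewrite {2}/flip; case: ifP => [sw|/negbT sw].
  by rewrite /flip (negbTE (behead_word_starts m w)) behead_wordK.
by rewrite /flip starts_prepend prependK.
Qed.

Lemma flip_computable m : computable (flip m).
Proof.
have [eA B1] := expn2_bounds m.
have A_gt0 : 0 < 2 ^ m.+2 by rewrite expn_gt0.
have cX : tcomputable (fun v : 1.-tuple nat => thead v) by exact: tcomputable_tnth.
have cst k : tcomputable (fun v : 1.-tuple nat => k) by exact: tcomputable_cst.
apply/computableP; apply: tcomputable_if.
- by apply: tcomputable_eqn; [exact: tcomputable_modn|exact: cst].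
- have cq := tcomputable_divn A_gt0 cX.
  have cr : tcomputable (fun v : 1.-tuple nat => thead v %/ 2 ^ m.+2 %% (2 ^ m.+2).-1).
    by apply: tcomputable_modn => //; lia.
  apply: tcomputable_add; last by apply: tcomputable_add; [exact: tcomputable_leq|].
  by apply: tcomputable_mul; [exact: cst|apply: tcomputable_divn => //; lia].
- have cr : tcomputable (fun v : 1.-tuple nat => thead v %% 2 ^ m.+2).
    exact: tcomputable_modn.
  apply: tcomputable_add; last exact: cst.
  apply: tcomputable_mul; first exact: cst.
  apply: tcomputable_add; last first.
    by apply: tcomputable_sub => //; apply: tcomputable_leq => //; exact: cst.
  by apply: tcomputable_mul; [exact: cst|exact: tcomputable_divn].
Qed.

Definition flip_bij m : computable_bij :=
  ComputableBij (@flipK m) (@flipK m) (flip_computable m).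

(** The argument [n] is fuel; w steps suffice because each removal of a letter decreases the number.
    The letter is sought below w, where it must lie since 2^(m+1) <= w. *)
Fixpoint spell n w : seq nat * nat :=
  if n is n'.+1 then
    if [pick m : 'I_w | starts m w] is Some m then
      let s := spell n' (behead_word m w) in (val m :: s.1, s.2)
    else ([::], w)
  else ([::], w).

Definition word w := (spell w w).1.
Definition base w := (spell w w).2.

Lemma starts_ltn m w : starts m w -> m < w.
Proof.
rewrite /starts => /eqP wB; have [_ _] := expn2_bounds m.
have : m.+1 < 2 ^ m.+1 by exact: ltn_expl.
by have := leq_mod w (2 ^ m.+2); lia.
Qed.

Lemma spell_starts n m w : starts m w ->
  spell n.+1 w = (m :: (spell n (behead_word m w)).1, (spell n (behead_word m w)).2).
Proof.
move=> mw /=; case: pickP => [m' /(starts_inj mw) <-//|].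
by move=> /(_ (Ordinal (starts_ltn mw))) /=; rewrite mw.
Qed.

Lemma spell_fuel n w : w <= n -> spell n w = spell w w.
Proof.
elim/ltn_ind: n w => -[|n] IH w; first by rewrite leqn0 => /eqP ->.
case: w => [|w] wn; first by rewrite /=; case: pickP => // -[].
rewrite /=; case: pickP => // m mw.
have := ltn_behead_word mw; rewrite ltnS => lt_w.
by rewrite (IH n)// ?(IH w)//; lia.
Qed.

Lemma word_starts m w : starts m w ->
  word w = m :: word (behead_word m w) /\ base w = base (behead_word m w).
Proof.
move=> mw; have lt_w := ltn_behead_word mw; rewrite /word /base.
case: w mw lt_w => // w mw lt_w; rewrite (spell_starts _ mw) /=.
by rewrite spell_fuel.
Qed.

Lemma word_prepend m w : ~~ starts m w ->
  word (prepend m w) = m :: word w /\ base (prepend m w) = base w.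
Proof.
by move=> mw; have := word_starts (starts_prepend m w); rewrite prependK.
Qed.

Lemma word_odd w : odd w -> word w = [::] /\ base w = w.
Proof.
move=> ow; rewrite /word /base; case: w ow => //= w ow.
case: pickP => //= m.
by rewrite (negbTE (@starts_odd m w.+1 _)).
Qed.

Section follow.
Variables (T : Type) (sig : nat -> T -> T).
Hypothesis sigK : forall m, involutive (sig m).

Definition follow w x := foldl (fun y m => sig m y) x (word w).

(** The first letter acts first, so prepending m moves the starting point to [sig m x]; cancelling
    an initial m does the same because [sig m] is an involution. *)
Lemma follow_flip m w x : follow (flip m w) x = follow w (sig m x).
Proof.
rewrite /follow /flip; case: ifP => [sw|/negbT sw].
  by have [-> _] := word_starts sw; rewrite /= sigK.
by have [-> _] := word_prepend sw.
Qed.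

Lemma follow_odd w x : odd w -> follow w x = x.
Proof. by rewrite /follow => /word_odd[-> _]. Qed.

End follow.

Lemma base_flip m w : base (flip m w) = base w.
Proof.
rewrite /flip; case: ifP => [sw|/negbT sw].
  by have [_ ->] := word_starts sw.
by have [_ ->] := word_prepend sw.
Qed.

(** * The Cantor space *)

(** The filter generated by the cylinders around y converges to y, since it does so in each
    coordinate. *)
Lemma nbhs_cantor (y : cantor_space) (O : set cantor_space) :
  nbhs y O -> exists n, forall z : cantor_space, (forall i, i < n -> z i = y i) -> O z.
Proof.
pose cyl n := [set z : cantor_space | forall i, i < n -> z i = y i].
pose F := filter_from [set: nat] cyl.
have FF : Filter F.
  apply: filter_from_filter; first by exists 0.
  move=> i j _ _; exists (maxn i j) => // z zij.
  by split=> k ki; apply: zij; rewrite leq_max ki ?orbT.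
suff : F --> y by move=> /[apply] -[n _ nO]; exists n => z /nO.
apply/cvg_sup => i; apply/cvg_image.
  by rewrite eqEsubset; split=> // b _; exists (fun=> b).
move=> A /principal_filterP Ayi; exists [set z : cantor_space | A (z i)].
  by exists i.+1 => // z /(_ i (ltnSn i)) /= ->.
rewrite eqEsubset; split=> [_ [z Az <-]//|b Ab].
by exists (fun=> b).
Qed.

Section cantor_metric.
Variable R : realType.

(** A copy of the Cantor space that carries a pseudometric with values in [R], as the definition of
    standard Borel spaces demands; compactness gives its completeness. *)
Definition cantor_metric : Type := prod_topology (fun _ : nat => bool).

HB.instance Definition _ := Pointed.on cantor_metric.
HB.instance Definition _ := PseudoMetric.copy cantor_metric
  (prod_topology (fun _ : nat => (bool : pseudoMetricType R))).

Lemma cantor_metric_complete (F : set_system cantor_metric) :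
  ProperFilter F -> cauchy F -> cvg F.
Proof.
by move=> PF cF; exact: (compact_cauchy_cvg PF cF filterT cantor_space_compact).
Qed.

HB.instance Definition _ :=
  Uniform_isComplete.Build cantor_metric cantor_metric_complete.

Lemma polish_cantor_metric : polish cantor_metric.
Proof.
split; first exact: cantor_space_hausdorff.
exists (range (fun (s : seq bool) (i : nat) => nth false s i)).
  by apply: (sub_countable (card_image_le _ _)); exact: countableP.
move=> O [y Oy] oO; have : nbhs (y : cantor_space) O by exact: open_nbhs_nbhs.
move=> /nbhs_cantor[n nO]; exists (fun i => nth false (mkseq y n) i); split.
  by apply: nO => i lt_in; rewrite nth_mkseq.
by exists (mkseq y n).
Qed.

Lemma standard_borel_cantor : standard_borel R (borel cantor_space).
Proof.
by exists cantor_metric, id, id; split => //; exact: polish_cantor_metric.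
Qed.

End cantor_metric.

Lemma measurable_coordinate i : measurable [set y : borel cantor_space | y i].
Proof.
have -> : [set y : borel cantor_space | y i] =
    @proj nat (fun=> bool : topologicalType) i @^-1` [set true].
  by apply/seteqP; split=> y /=; rewrite /proj => ->.
apply: sub_sigma_algebra; apply: open_comp; last exact: discrete_open.
by move=> ? _; exact: proj_continuous.
Qed.

(** An open set is a union of cylinders, and there are only countably many of these. *)
Lemma measurable_fun_cantor d (T : measurableType d) (f : T -> borel cantor_space) :
  (forall i, measurable [set x | f x i]) -> measurable_fun setT f.
Proof.
move=> mf.
pose cyl (s : seq bool) := [set x | forall i, i < size s -> f x i = nth false s i].
have mcyl s : measurable (cyl s).
  rewrite (_ : cyl s = \bigcap_(i in [set i | i < size s])
      (if nth false s i then [set x | f x i] else ~` [set x | f x i])).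
    apply: bigcap_measurableType => i _; case: ifP => _; first exact: mf.
    by apply: measurableC; exact: mf.
  apply/seteqP; split=> x xs i /= si; have := xs i si.
    by case: nth => /= fi; rewrite fi.
  by case: nth => //= /negP/negbTE.
apply: (@measurability _ _ T (borel cantor_space) setT f (@open cantor_space)) => //.
move=> _ [V oV <-]; rewrite setTI.
rewrite (_ : f @^-1` V = \bigcup_(s in [set s | cyl s `<=` f @^-1` V]) cyl s).
  rewrite bigcup_mkcond; apply: countable_bigcupT_measurable => [|s].
    exact: countableP.
  by case: ifP.
apply/seteqP; split=> x; last by move=> [s /= sV xs]; exact: sV.
move=> Vfx; have : nbhs (f x : cantor_space) V by exact: open_nbhs_nbhs.
move=> /nbhs_cantor[n nV]; exists (mkseq (f x) n) => [z /= zs|i].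
  by apply: nV => i lt_in; rewrite zs ?size_mkseq// nth_mkseq.
by rewrite size_mkseq => lt_in; rewrite nth_mkseq.
Qed.

(** * Recursive isomorphism as a countable Borel equivalence relation *)

Section measurable_sets.
Context d (T : measurableType d).

Lemma measurable_preimage d' (T' : measurableType d') (f : T -> T') (A : set T') :
  measurable_fun setT f -> measurable A -> measurable (f @^-1` A).
Proof. by move=> mf mA; rewrite -[_ @^-1` _]setTI; exact: mf. Qed.

Lemma measurable_coordinate_fun (f : T -> borel cantor_space) i :
  measurable_fun setT f -> measurable [set x | f x i].
Proof. by move=> mf; exact: measurable_preimage mf (measurable_coordinate i). Qed.

Lemma measurable_eqb (p q : T -> bool) : measurable [set x | p x] ->
  measurable [set x | q x] -> measurable [set x | p x = q x].
Proof.
move=> mp mq; rewrite (_ : [set x | p x = q x] =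
  ([set x | p x] `&` [set x | q x]) `|` (~` [set x | p x] `&` ~` [set x | q x])).
  by apply: measurableU; apply: measurableI => //; exact: measurableC.
apply/seteqP; split=> x /=; first by move=> ->; case: (q x); [left|right].
by move=> [[-> ->]//|[/negP/negbTE -> /negP/negbTE ->]].
Qed.

Lemma measurable_exists (I : countType) (P : I -> T -> Prop) :
  (forall i, measurable [set x | P i x]) -> measurable [set x | exists i, P i x].
Proof.
move=> mP; rewrite (_ : [set x | _] = \bigcup_i [set x | P i x]).
  by apply: countable_bigcupT_measurable => //; exact: countableP.
by apply/seteqP; split=> x [i]; [exists i|exists i].
Qed.

Lemma measurable_forall (I : countType) (P : I -> T -> Prop) :
  (forall i, measurable [set x | P i x]) -> measurable [set x | forall i, P i x].
Proof.
move=> mP; rewrite (_ : [set x | _] = ~` [set x | exists i, (~` [set x | P i x]) x]).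
  apply: measurableC; apply: measurable_exists => i; exact: measurableC (mP i).
apply/seteqP; split=> x /=; first by move=> H [i]; apply; exact: H.
by move=> /forallNP H i; exact: contrapT (H i).
Qed.

Lemma measurable_const_set (P : Prop) : measurable [set _ : T | P].
Proof.
have [p|np] := pselect P; last by rewrite (_ : mkset _ = set0)// -subset0.
by rewrite (_ : mkset _ = setT)//; apply/seteqP; split.
Qed.

End measurable_sets.

Lemma rec_iso_equivalence : RelationClasses.Equivalence rec_iso.
Proof.
split.
- move=> x; exists (@ComputableBij id id (fun=> erefl) (fun=> erefl) computable_id).
  by [].
- move=> x _ [g <-]; exists (ComputableBij (@cbij_invK g) (@cbijK g) (cbij_inv_computable g)).
  by apply: funext => n; rewrite /perm_act /= cbijK.
- move=> x _ _ [g <-] [h <-].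
  exists (ComputableBij (can_comp (@cbijK h) (@cbijK g))
    (can_comp (@cbij_invK g) (@cbij_invK h))
    (computable_comp (cbij_computable h) (cbij_computable g))).
  by [].
Qed.

Lemma rec_iso_enum : exists (h : nat -> nat -> nat) (I : set nat),
  forall x y, rec_iso x y <-> exists2 i, I i & y = x \o h i.
Proof.
have [h hP] := computable_bij_enum.
exists h, [set i | exists g : computable_bij, cbij_inv g = h i] => x y; split.
  by move=> [g <-]; have [i gi] := hP g; exists i; [exists g|rewrite -gi].
by move=> [i [g gi] ->]; exists g; rewrite -gi.
Qed.

(** The relation is a countable union of graphs of coordinate permutations, each defined by
    countably many equations between bits. *)
Lemma rec_iso_countable_borel (R : realType) : countable_borel_equivalence R rec_iso.
Proof.
have [h [I hI]] := rec_iso_enum.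
split; [exact: standard_borel_cantor|exact: rec_iso_equivalence| |].
- rewrite (_ : [set p | _] = \bigcup_(i in I)
      [set p : borel cantor_space * borel cantor_space | forall n, p.2 n = p.1 (h i n)]).
    apply: bigcup_measurable => i _; apply: measurable_forall => n.
    by apply: measurable_eqb; apply: measurable_coordinate_fun.
  apply/seteqP; split=> -[x y] /=.
    by move=> /hI[i Ii ->]; exists i.
  by move=> [i Ii yx]; apply/hI; exists i => //; apply: funext => n; exact: yx.
- move=> x; apply: (sub_countable (B := range (fun i => x \o h i))).
    by apply: subset_card_le => y /hI[i _ ->]; exists i.
  by apply: (sub_countable (card_image_le _ _)); exact: countableP.
Qed.

(** * Standard Borel spaces are Borel retracts of the Cantor space *)

Definition first_index (z : nat -> bool) : nat :=
  if pselect (exists j, z j) is left e then ex_minn e else 0%N.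

Lemma first_indexP (z : nat -> bool) : (exists j, z j) -> z (first_index z).
Proof. by move=> e; rewrite /first_index; case: pselect => // e'; case: ex_minnP. Qed.

(** Spelling out the fibres, with the default value 0, exhibits them as countable Boolean
    combinations of the conditions z i. *)
Lemma first_index_eq (z : nat -> bool) j : first_index z = j <->
  (z j /\ forall i, (i < j)%N -> ~ z i) \/ (j = 0%N /\ forall i, ~ z i).
Proof.
rewrite /first_index; case: pselect => [e|ne].
  case: ex_minnP => m zm min_m; split=> [<-|[[zj jmin]|[_ nz]]].
  - by left; split=> // i im zi; have := min_m i zi; rewrite leqNgt im.
  - apply/eqP; rewrite eqn_leq min_m//= leqNgt; apply/negP => /jmin; exact.
  - by have := nz m.
split=> [<-|[[zj _]|[-> //]]]; first by right; split=> // i zi; apply: ne; exists i.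
by exfalso; apply: ne; exists j.
Qed.

Lemma measurable_first_index d (T : measurableType d) (z : T -> nat -> bool) (P : nat -> Prop) :
  (forall j, measurable [set x | z x j]) -> measurable [set x | P (first_index (z x))].
Proof.
move=> mz; rewrite (_ : [set x | _] =
    [set x | exists j, P j /\ first_index (z x) = j]); last first.
  by apply/seteqP; split=> x /=; [move=> Px; eexists; split; eauto|move=> [j [Pj ->]]].
apply: measurable_exists => j.
have [Pj|nPj] := pselect (P j); last by rewrite (_ : mkset _ = set0)// -subset0 => x [].
rewrite (_ : [set x | _] = ([set x | z x j] `&` [set x | forall i, (i < j)%N -> ~ z x i]) `|`
    ([set x | j = 0%N /\ forall i, ~ z x i])); last first.
  apply/seteqP; split=> x /=; first by move=> [_ /first_index_eq].
  by move=> ?; split=> //; exact/first_index_eq.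
apply: measurableU.
  apply: measurableI => //; apply: measurable_forall => i.
  have [ij|ij] := boolP (i < j)%N; last by rewrite (_ : mkset _ = setT)//; apply/seteqP; split.
  rewrite (_ : mkset _ = ~` [set x | z x i]); first exact: measurableC.
  by apply/seteqP; split=> x /=; [apply|].
have [->|j0] := eqVneq j 0%N; last first.
  by rewrite (_ : mkset _ = set0)// -subset0 => x [/eqP]; rewrite (negbTE j0).
rewrite (_ : mkset _ = [set x | forall i, ~ z x i]); last first.
  by apply/seteqP; split=> x /=; [case|].
by apply: measurable_forall => i; exact: (@measurableC _ _ [set x | z x i]).
Qed.

Section polish_retract.
Local Open Scope ring_scope.
Variables (R : realType) (U : completePseudoMetricType R).
Hypothesis polishU : polish U.

Let e (k : nat) : R := k.+1%:R^-1.
Let e_gt0 k : 0 < e k. Proof. by rewrite invr_gt0. Qed.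

Let e_lt (a : R) : 0 < a -> exists N, forall n, (N <= n)%N -> e n < a.
Proof.
by move=> a_gt0; have [N _ NP] := near_infty_natSinv_lt (PosNum a_gt0); exists N.
Qed.

(** Balls need not be open for a pseudometric structure, so x is asked to be in the interior. A
    dense point within e k / 4 of x works, as the e k / 4-ball around x then lies in its e
    k-ball. *)
Lemma polish_dense_seq : exists u : nat -> U, forall x k,
  exists j, (ball (u j) (e k))° x.
Proof.
have [_ [D cD dD]] := polishU.
have [x0 [_ Dx0]] := dD setT (ex_intro _ point I) openT.
have [f Df] : exists f : nat -> U, D `<=` range f.
  have /pcard_leP[g] := cD; pose f n := xget x0 [set x | D x /\ g x = n].
  exists f => x Dx; exists (g x) => //; rewrite /f.
  case: xgetP => [y _ [Dy gyx]|/(_ x)]; last by case.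
  by apply: ('inj_g); rewrite ?inE.
exists f => x k.
have e4 : 0 < e k / 4 by rewrite divr_gt0.
have [y [/interior_subset xy /Df[j _ fj]]] : (ball x (e k / 4))° `&` D !=set0.
  apply: dD; last exact: open_interior.
  by exists x; apply: nbhsx_ballx.
exists j; rewrite fj; apply: filterS (nbhsx_ballx x _ e4) => z xz.
by apply: le_ball (ball_triangle (ball_sym xy) xz); have := e_gt0 k; lra.
Qed.

Let ball_eq (x y : U) (a : R) : (forall k, ball x (a * e k) y) -> x = y.
Proof.
move=> xy; apply: (close_eq polishU.1); rewrite ball_close => eps.
(* The maximum with 1 is a positive divisor whatever the sign of [a]. *)
have b_gt0 : 0 < Num.max a 1 by rewrite lt_max ltr01 orbT.
have c_gt0 : 0 < eps%:num / Num.max a 1 by rewrite divr_gt0.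
have [N /(_ N (leqnn N)) eN] := e_lt c_gt0.
apply: le_ball (xy N); move: eN; rewrite ltr_pdivlMr// mulrC => /ltW; apply: le_trans.
by rewrite ler_wpM2r ?(ltW (e_gt0 N))// le_max lexx.
Qed.

Lemma polish_retract :
  exists (f : borel U -> borel cantor_space) (g : borel cantor_space -> borel U),
    [/\ measurable_fun setT f, measurable_fun setT g & cancel f g].
Proof.
(* f x lists the balls around the points of a dense sequence that contain x, and
   g z is the limit of the first listed centres of radius e k, if they converge
   fast enough. *)
have [u uP] := polish_dense_seq.
pose f (x : borel U) : borel cantor_space := fun n =>
  if unpickle n is Some (j, k) then `[< (ball (u j) (e k))° x >] else false.
have fE x (j k : nat) : f x (pickle (j, k)) = `[< (ball (u j) (e k))° x >] by rewrite /f pickleK.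
pose c (z : borel cantor_space) (k : nat) := first_index (fun j => z (pickle (j, k))).
have mc k (P : nat -> Prop) : measurable [set z | P (c z k)].
  by apply: measurable_first_index => j; exact: measurable_coordinate.
(* The radius e k + e l is what two balls of radii e k and e l with a common point guarantee. *)
pose cau (z : borel cantor_space) := forall k l, ball (u (c z k)) (e k + e l) (u (c z l)).
have mcau : measurable [set z | cau z].
  apply: measurable_forall => k; apply: measurable_forall => l.
  rewrite (_ : mkset _ = [set z | exists j, c z k = j /\
      ball (u j) (e k + e l) (u (c z l))]); last first.
    by apply/seteqP; split=> z /=; [move=> ?; exists (c z k)|move=> [j [->]]].
  apply: measurable_exists => j; apply: measurableI; first exact: (mc k (fun i => i = j)).
  exact: (mc l (fun i => ball (u j) (e k + e l) (u i))).
have lim_ex z : exists x, cau z -> forall k, ball (u (c z k)) (2 * e k) x.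
  have [cz|] := pselect (cau z); last by exists point.
  pose v k := u (c z k).
  have /cauchy_cvg/cvg_ex[x vx] : cauchy (v @ \oo).
    apply: cauchy_exP => eps eps_gt0.
    have eps2 : 0 < eps / 2 by rewrite divr_gt0.
    have [N NP] := e_lt eps2.
    exists (v N), N => // l /NP el; apply: le_ball (cz N l).
    by have := NP N (leqnn N); lra.
  exists x => _ k; have ek2 : 0 < e k / 2 by rewrite divr_gt0.
  have [N NP] := e_lt ek2.
  have [M _ MP] := cvg_ball vx ek2.
  have := MP (maxn M N) (leq_maxl _ _) => /ball_sym.
  move=> /(ball_triangle (cz k (maxn M N))); apply: le_ball.
  by have := NP (maxn M N) (leq_maxr _ _); lra.
have [h hP] := choice lim_ex.
pose g (z : borel cantor_space) : borel U := if pselect (cau z) then h z else point.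
have gP z k : cau z -> ball (u (c z k)) (2 * e k) (g z).
  by move=> cz; rewrite /g; case: (pselect (cau z)) => [?|]; [exact: hP|].
exists f, g; split.
- apply: measurable_fun_cantor => n; rewrite /f /=.
  case: (unpickle n) => [[j k]|]; last by rewrite (_ : mkset _ = set0)// -subset0.
  rewrite (_ : mkset _ = (ball (u j) (e k))°).
    by apply: sub_sigma_algebra; exact: open_interior.
  by apply/seteqP; split=> x /asboolP.
- apply: (@measurability _ _ (borel cantor_space) (borel U) setT g (@open U)) => //.
  move=> _ [V oV <-]; rewrite setTI.
  (* The limit lies in V iff one of the balls of radius 2 e k about the listed centres lies in V.
     This is a condition on the integers [c z k] only. *)
  rewrite (_ : g @^-1` V = ([set z | cau z] `&`
      [set z | exists k, ball (u (c z k)) (2 * e k) `<=` V]) `|`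
    (~` [set z | cau z] `&` [set z | V point])).
    apply: measurableU; apply: measurableI => //.
    + apply: measurable_exists => k; exact: (mc k (fun j => ball (u j) (2 * e k) `<=` V)).
    + exact: measurableC.
    + have [Vp|nVp] := pselect (V point).
        by rewrite (_ : mkset _ = setT)//; apply/seteqP; split.
      by rewrite (_ : mkset _ = set0)// -subset0.
  apply/seteqP; split=> z /=.
    have [cz|ncz] := pselect (cau z); last by rewrite /g; case: (pselect (cau z)) => [//|?]; right.
    move=> Vgz; left; split=> //.
    have /nbhs_ballP[eps /= eps_gt0 epsV] : nbhs (g z : U) V by exact: open_nbhs_nbhs.
    have eps4 : 0 < eps / 4 by rewrite divr_gt0.
    have [k /(_ k (leqnn k)) kP] := e_lt eps4.
    exists k => y /(ball_triangle (ball_sym (gP z k cz))) yz; apply: epsV.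
    by apply: le_ball yz; lra.
  move=> [[cz [k kV]]|[ncz Vp]]; first by apply: kV; exact: gP.
  by rewrite /g; case: (pselect (cau z)).
- move=> x; have xc k : ball (u (c (f x) k)) (e k) x.
    have [j jx] := uP x k.
    have /first_indexP : exists i : nat, f x (pickle (i, k)) by exists j; rewrite fE; apply/asboolP.
    by rewrite -/(c (f x) k) fE => /asboolP/interior_subset.
  have cfx : cau (f x).
    by move=> k l; exact: ball_triangle (xc k) (ball_sym (xc l)).
  apply: (@ball_eq _ _ 3) => k.
  rewrite (_ : 3 * e k = 2 * e k + e k); last by lra.
  exact: ball_triangle (ball_sym (gP _ k cfx)) (xc k).
Qed.

End polish_retract.

Lemma standard_borel_retract (R : realType) d (T : measurableType d) :
  standard_borel R T ->
  exists (f : T -> borel cantor_space) (g : borel cantor_space -> T),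
    [/\ measurable_fun setT f, measurable_fun setT g & cancel f g].
Proof.
move=> [U [f [g [pU mf mg fK _]]]].
have [f' [g' [mf' mg' f'K]]] := polish_retract pU.
exists (f' \o f), (g \o g'); split.
- exact: measurableT_comp mf' mf.
- exact: measurableT_comp mg mg'.
- exact: can_comp.
Qed.

(** * Souslin representation of measurable sets *)

Section souslin.
Context d (X : measurableType d).
Implicit Types (y : nat -> bool) (al : nat -> nat) (B : set (X * borel cantor_space)).

Definition agree N y al y' al' :=
  forall i, (i < N)%N -> y' i = y i /\ al' i = al i.

Definition locally_constant (V : Type) (K : (nat -> bool) -> (nat -> nat) -> V) :=
  forall y al, exists N, forall y' al', agree N y al y' al' -> K y' al' = K y al.

Definition souslin_scheme (K : nat -> (nat -> bool) -> (nat -> nat) -> set X) :=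
  (forall n y al, measurable (K n y al)) /\ (forall n, locally_constant (K n)).

(* The values [K n y al] of a scheme are clopen in (y, al); they take the place of
   the closed sets indexed by finite sequences of the usual Souslin operation. *)
Definition souslin B := exists2 K, souslin_scheme K &
  forall x y, B (x, y) <-> exists al, forall n, K n y al x.

(** The first entry of the witness [al] selects the set, the rest is a witness for it. *)
Lemma souslin_bigcup (F : nat -> set (X * borel cantor_space)) :
  (forall i, souslin (F i)) -> souslin (\bigcup_i F i).
Proof.
move=> sF; have /choice[K KP] : forall i, exists K, souslin_scheme K /\
    forall x y, F i (x, y) <-> exists al, forall n, K n y al x.
  by move=> i; have [K ? ?] := sF i; exists K.
exists (fun n y al => K (al 0%N) n y (fun k => al k.+1)).
  split=> [n y al|n y al]; first by case: (KP (al 0%N)) => -[].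
  case: (KP (al 0%N)) => -[_ /(_ n y (fun k => al k.+1))[N HN]] _.
  exists N.+1 => y' al' H; have [_ ->] := H 0%N isT.
  apply: HN => i iN; split; first by case: (H i (ltnW iN)).
  by case: (H i.+1 iN).
move=> x y; split=> [[i _ /(KP i).2[al Hal]]|[al Hal]].
  by exists (fun k => if k is k'.+1 then al k' else i).
by exists (al 0%N) => //; apply/(KP (al 0%N)).2; exists (fun k => al k.+1).
Qed.

(** One sequence [al] codes a witness for each set as its rows, and condition n, decoded as (i, m),
    is the m-th condition on row i. *)
Lemma souslin_bigcap (F : nat -> set (X * borel cantor_space)) :
  (forall i, souslin (F i)) -> souslin (\bigcap_i F i).
Proof.
move=> sF; have /choice[K KP] : forall i, exists K, souslin_scheme K /\
    forall x y, F i (x, y) <-> exists al, forall n, K n y al x.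
  by move=> i; have [K ? ?] := sF i; exists K.
pose row (i : nat) al k := al (pickle (i, k : nat)).
exists (fun n y al => if unpickle n is Some (i, m) then K i m y (row i al) else setT).
  split=> [n y al|n y al]; case: (unpickle n) => [[i m]|] //.
  - by case: (KP i) => -[].
  - case: (KP i) => -[_ /(_ m y (row i al))[N HN]] _.
    (* Long enough to fix the first N entries of row i. *)
    exists (maxn N (\max_(k < N) (pickle (i, k : nat)).+1)) => y' al' H; apply: HN => k kN.
    split; first by case: (H k); rewrite // leq_max kN.
    case: (H (pickle (i, k))) => //; rewrite leq_max; apply/orP; right.
    exact: (@leq_bigmax _ (fun k : 'I_N => (pickle (i, k : nat)).+1) (Ordinal kN)).
  - by exists 0%N.
move=> x y; split=> [Fxy|[al Hal] i _].
  have /choice[al Hal] : forall i, exists al, forall n, K i n y al x.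
    by move=> i; apply/(KP i).2; exact: Fxy.
  exists (fun n => if unpickle n is Some (i, k) then al i k else 0%N) => n.
  case: (unpickle n) => [[i m]|] //.
  rewrite (_ : row i _ = al i); first exact: Hal.
  by apply: funext => k; rewrite /row pickleK.
apply/(KP i).2; exists (row i al) => m.
by have := Hal (pickle (i, m)); rewrite pickleK.
Qed.

Lemma souslin_fst (A : set X) : measurable A -> souslin (A `*` setT).
Proof.
move=> mA; exists (fun _ _ _ => A); first by split=> // n y al; exists 0%N.
by move=> x y; split=> [[Ax _]|[_ /(_ 0%N)]]; first by exists (fun=> 0%N).
Qed.

(** The witness is the length of an initial segment of y whose cylinder lies in V. *)
Lemma souslin_open (V : set cantor_space) : open V -> souslin (setT `*` V).
Proof.
move=> oV.
exists (fun _ y al => [set _ : X | [set z | forall i, (i < al 0)%N -> z i = y i] `<=` V]).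
  split=> [n y al|n y al]; first exact: measurable_const_set.
  exists (al 0).+1 => y' al' H; have [_ e0] := H 0%N isT.
  apply/seteqP; split=> x /= HV z zy; apply: HV => i.
    by rewrite e0 => ial; rewrite zy//; case: (H i (ltnW ial)).
  by move=> ial; rewrite zy ?e0//; case: (H i (ltnW ial)).
move=> x y; split=> [[_ Vy]|[al /(_ 0%N) H]]; last by split=> //; exact: H.
have : nbhs (y : cantor_space) V by exact: open_nbhs_nbhs.
by move=> /nbhs_cantor[n nV]; exists (fun=> n).
Qed.

Lemma souslin_openC (V : set cantor_space) : open V -> souslin (~` (setT `*` V)).
Proof.
move=> oV.
exists (fun n y _ => [set _ : X | ~ [set z | forall i, (i < n)%N -> z i = y i] `<=` V]).
  split=> [n y al|n y al]; first exact: measurable_const_set.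
  exists n => y' al' H; apply/seteqP; split=> x /= HV sV; apply: HV => z zy; apply: sV => i ni.
    by rewrite zy//; case: (H i ni).
  by rewrite zy//; case: (H i ni).
move=> x y; split=> [nV|[al H] [_ Vy]].
  by exists (fun=> 0%N) => n sV; apply: nV; split=> //; apply: sV.
have : nbhs (y : cantor_space) V by exact: open_nbhs_nbhs.
by move=> /nbhs_cantor[n /H].
Qed.

(** The sets that are Souslin together with their complements form a sigma-algebra; it contains the
    cylinders over measurable subsets of X and over open sets, hence over Borel sets. *)
Lemma measurable_souslin B : measurable B -> souslin B.
Proof.
move=> mB; pose S := [set A : set (X * borel cantor_space) | souslin A /\ souslin (~` A)].
have S_sigma : sigma_algebra setT S.
  split.
  - split; first by have := souslin_fst measurable0; rewrite set0X.
    by have := souslin_fst measurableT; rewrite setXTT setC0.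
  - by move=> A [? ?]; rewrite setTD; split=> //; rewrite setCK.
  - move=> F SF; split; first by apply: souslin_bigcup => i; case: (SF i).
    by rewrite setC_bigcup; apply: souslin_bigcap => i; case: (SF i).
suff : @measurable _ (X * borel cantor_space)%type `<=` S by move=> /(_ _ mB)[].
apply: smallest_sub => // _ [[A mA <-]|[A mA <-]]; rewrite setTI.
  have -> : fst @^-1` A = A `*` (setT : set (borel cantor_space)).
    by apply/seteqP; split=> [[? ?] /=|[? ?] []].
  split; first exact: souslin_fst.
  rewrite (_ : ~` _ = (~` A) `*` setT); first by apply: souslin_fst; exact: measurableC.
  by apply/seteqP; split=> [[? ?] /= H|[? ?] /= [H _] []//]; split=> // ?; exact: H.
have -> : snd @^-1` A = (setT : set X) `*` A.
  by apply/seteqP; split=> [[? ?] /=|[? ?] []].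
pose S' := [set A : set (borel cantor_space) | S (setT `*` A)].
suff : @measurable _ (borel cantor_space) `<=` S' by apply.
have setXC (D : set (borel cantor_space)) : ~` ((setT : set X) `*` D) = setT `*` ~` D.
  by apply/seteqP; split=> [[? ?] /= H|[? ?] /= [_ H] []//]; split=> // ?; exact: H.
apply: smallest_sub; last by move=> V oV; split; [exact: souslin_open|exact: souslin_openC].
have [S0 SD SU] := S_sigma; split.
- by rewrite /S' /= setX0.
- by move=> D SD'; rewrite setTD /S' /= -setXC; have := SD _ SD'; rewrite setTD.
- move=> F SF; rewrite /S' /= (_ : _ `*` _ = \bigcup_k (setT `*` F k)); first exact: SU.
  by apply/seteqP; split=> [[x y] [_ [k _ Fy]]|[x y] [k _ [_ Fy]]]; [exists k|split=> //; exists k].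
Qed.

End souslin.

(** * Probability measures with real values *)

Section real_probability.
Local Open Scope ring_scope.
Context (R : realType) d (X : measurableType d) (mu : probability X R).
Implicit Types A B : set X.

Definition rprob A : R := fine (mu A).

Lemma rprobE A : measurable A -> mu A = (rprob A)%:E.
Proof. by move=> mA; rewrite /rprob fineK//; exact: fin_num_measure. Qed.

Lemma rprob_ge0 A : 0 <= rprob A.
Proof. exact: fine_ge0. Qed.

Lemma rprob_le1 A : measurable A -> rprob A <= 1.
Proof. by move=> mA; rewrite -lee_fin -rprobE//; exact: probability_le1. Qed.

Lemma le_rprob A B : measurable A -> measurable B -> A `<=` B -> rprob A <= rprob B.
Proof.
by move=> mA mB AB; rewrite -lee_fin -!rprobE//; apply: le_measure; rewrite ?inE.
Qed.

Lemma rprob_setID A B : measurable A -> measurable B ->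
  rprob A = rprob (A `&` B) + rprob (A `\` B).
Proof.
move=> mA mB; apply: EFin_inj; rewrite EFinD -!rprobE//.
- by rewrite -{1}(setIT A) -(setUv B) setIUr measureU//;
    [exact: measurableI|by apply: measurableI => //; exact: measurableC|
     by rewrite setIACA setICr !setI0].
- exact: measurableD.
- exact: measurableI.
Qed.

Lemma negligible_rprob A : measurable A -> mu.-negligible A <-> rprob A = 0.
Proof.
move=> mA; split=> [/(negligibleP _ mA) A0|A0].
  by rewrite /rprob A0.
by apply/(negligibleP _ mA); rewrite -[LHS]/(mu A) rprobE// A0.
Qed.

Lemma rprob_bigcap_lt (F : nat -> set X) (e : R) : (forall n, measurable (F n)) ->
  (forall n, F n.+1 `<=` F n) -> \bigcap_n F n = set0 -> 0 < e ->
  exists n, rprob (F n) < e.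
Proof.
move=> mF dF F0 e_gt0.
have nF : nonincreasing_seq F by apply/nonincreasing_seqP => n; apply/subsetPset.
have := nonincreasing_cvg_mu (mu := mu) _ mF (bigcapT_measurable mF) nF.
rewrite F0 measure0 => /(_ ltac:(by rewrite ltey_eq fin_num_measure))/fine_cvgP[_].
move=> /cvgrPdist_lt/(_ e e_gt0)[N _ /(_ N (leqnn N)) /=].
by rewrite sub0r normrN ger0_norm ?rprob_ge0// => ?; exists N.
Qed.

Lemma negligible_exists (I : countType) (F : I -> set X) :
  (forall i, mu.-negligible (F i)) -> mu.-negligible [set x | exists i, F i x].
Proof.
move=> nF; apply: (@negligibleS _ _ _ _ (\bigcup_n (if unpickle n is Some i then F i else set0))).
  by move=> x [i Fix]; exists (pickle i) => //; rewrite pickleK.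
by apply: negligible_bigcup => n; case: unpickle => // *; exact: negligible_set0.
Qed.

(** Exhaustion: take the union of a sequence in P whose measures approach the supremum. A non-null
    remainder of D' would push the measure of the union with D' above the supremum. *)
Lemma maximal_mod_negligible (P : set X -> Prop) :
  P set0 -> (forall D, P D -> measurable D) ->
  (forall F : nat -> set X, (forall n, P (F n)) -> P (\bigcup_n F n)) ->
  exists2 D, P D & forall D', P D' -> mu.-negligible (D' `\` D).
Proof.
move=> P0 Pm PU; pose S := [set rprob D | D in P].
have supS : has_sup S.
  split; first by exists (rprob set0), set0.
  by exists 1 => _ [D PD <-]; apply: rprob_le1; exact: Pm.
have /choice[F FP] : forall n : nat, exists D, P D /\ sup S - n.+1%:R^-1 < rprob D.
  move=> n; have [|_ [D PD <-] lt_D] := @sup_adherent _ S n.+1%:R^-1 _ supS.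
    by rewrite invr_gt0.
  by exists D.
have PF n : P (F n) by case: (FP n).
exists (\bigcup_n F n) => [|D' PD']; first exact: PU.
have mU : measurable (\bigcup_n F n) by apply: Pm; exact: PU.
have mD' := Pm _ PD'.
apply/negligible_rprob; first exact: measurableD.
have PUD : P (\bigcup_n F n `|` D').
  have := PU (fun n => if n is n'.+1 then F n' else D').
  rewrite (_ : \bigcup_n _ = \bigcup_n F n `|` D'); first by apply; case.
  apply/seteqP; split=> [x [[|n] _ ?]|x [[n _ ?]|?]].
  - by right.
  - by left; exists n.
  - by exists n.+1.
  - by exists 0%N.
apply/eqP; rewrite eq_le rprob_ge0 andbT leNgt; apply/negP => gt0.
have := near_infty_natSinv_lt (PosNum gt0); move=> [n _ /(_ n (leqnn n)) /= nlt].
have /ub_le_sup : has_ubound S by case: supS.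
move=> /(_ (rprob (\bigcup_n F n `|` D'))) /(_ ltac:(by exists (\bigcup_n F n `|` D'))).
rewrite (rprob_setID (Pm _ PUD) mU) setIUl setIid (setUidl (@subIsetr _ _ _)).
rewrite setDUl setDv set0U.
have : rprob (F n) <= rprob (\bigcup_n F n).
  by apply: le_rprob => //; [exact: Pm|exact: bigcup_sup].
by move: (FP n).2 nlt; move: (n.+1%:R^-1) => a; lra.
Qed.

End real_probability.

(** * Lusin-Novikov uniformization almost everywhere *)

Section lusin_novikov.
Context (R : realType) d (X : measurableType d) (mu : probability X R).
Implicit Types (y : nat -> bool) (al : nat -> nat) (t : seq (bool * nat)) (x : X).

Let bits t i := (nth (false, 0%N) t i).1.
Let nums t i := (nth (false, 0%N) t i).2.
Let node y al n := mkseq (fun i => (y i, al i)) n.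

Definition extends t t' := (size t <= size t')%N /\
  agree (size t) (bits t) (nums t) (bits t') (nums t').

Let agree_node y al n : agree n y al (bits (node y al n)) (nums (node y al n)).
Proof. by move=> i lt_in; rewrite /bits /nums !nth_mkseq. Qed.

Let agree_sym N y al y' al' : agree N y al y' al' -> agree N y' al' y al.
Proof. by move=> H i /H[-> ->]. Qed.

Let agree_trans N y1 al1 y2 al2 y3 al3 :
  agree N y1 al1 y2 al2 -> agree N y2 al2 y3 al3 -> agree N y1 al1 y3 al3.
Proof. by move=> H H' i iN; case: (H' i iN) => -> ->; exact: H. Qed.

Let agree_le M N y al y' al' : (M <= N)%N -> agree N y al y' al' -> agree M y al y' al'.
Proof. by move=> MN H i iM; apply: H; exact: leq_trans MN. Qed.

Variable K : nat -> (nat -> bool) -> (nat -> nat) -> set X.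
Hypothesis schemeK : souslin_scheme K.

Let branch t x y := exists2 al, agree (size t) (bits t) (nums t) y al &
  forall n, K n y al x.

Let covered t (D : set X) := measurable D /\
  exists2 f : nat -> X -> borel cantor_space, (forall i, measurable_fun setT (f i)) &
    forall x y, D x -> branch t x y -> exists i, y = f i x.

Let covered_family t (D : set X) (I : countType) (f : I -> X -> borel cantor_space) :
  measurable D -> (forall i, measurable_fun setT (f i)) ->
  (forall x y, D x -> branch t x y -> exists i, y = f i x) -> covered t D.
Proof.
move=> mD mf Df; split=> //.
exists (fun n => if unpickle n is Some i then f i else cst point) => [n|x y Dx xy].
  by case: (unpickle n) => [i|]; [exact: mf|exact: measurable_cst].
by have [i ->] := Df x y Dx xy; exists (pickle i); rewrite pickleK.
Qed.

Let covered_bigcup t (F : nat -> set X) :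
  (forall n, covered t (F n)) -> covered t (\bigcup_n F n).
Proof.
move=> cF; have /choice[f fP] : forall n, exists f : nat -> X -> borel cantor_space,
    (forall i, measurable_fun setT (f i)) /\
    forall x y, F n x -> branch t x y -> exists i, y = f i x.
  by move=> n; have [_ [f mf Ff]] := cF n; exists f.
apply: (@covered_family _ _ (nat * nat)%type (fun p => f p.1 p.2)).
- by apply: bigcupT_measurable => n; case: (cF n).
- by move=> p; have [] := fP p.1; exact.
- move=> x y [n _ Fx] /((fP n).2 x y Fx)[i ->]; by exists (n, i).
Qed.

(** Over such x no branch passes through t, so these sets are covered trivially. *)
Let refuted t n : set X := [set x | forall y al,
  agree (size t) (bits t) (nums t) y al -> ~ K n y al x].

(** By local constancy it suffices to test the finite extensions of t, of which there are countably
    many. *)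
Let measurable_refuted t n : measurable (refuted t n).
Proof.
rewrite (_ : refuted t n = [set x | forall t', extends t t' -> ~ K n (bits t') (nums t') x]).
  apply: measurable_forall => t'.
  have [tt'|ntt'] := pselect (extends t t').
    rewrite (_ : mkset _ = ~` K n (bits t') (nums t')).
      by apply: measurableC; exact: schemeK.1.
    by apply/seteqP; split=> x /=; [apply|].
  by rewrite (_ : mkset _ = setT)//; apply/seteqP; split=> // x _ /= /ntt'.
apply/seteqP; split=> x /= H; first by move=> t' [_]; exact: H.
move=> y al tya; have [N HN] := schemeK.2 n y al.
pose t' := node y al (maxn N (size t)).
have e : agree (maxn N (size t)) y al (bits t') (nums t') by exact: agree_node.
rewrite -(HN (bits t') (nums t')); last exact: agree_le (leq_maxl _ _) e.
apply: H; split; first by rewrite size_mkseq leq_maxr.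
exact: agree_trans tya (agree_le (leq_maxr _ _) e).
Qed.

Let covered_refuted t n : covered t (refuted t n).
Proof.
apply: (@covered_family _ _ nat (fun=> cst point)) => // x y xt [al tya Kx].
by have := xt y al tya (Kx n).
Qed.

Lemma maximal_covered : exists D : seq (bool * nat) -> set X,
  (forall t, covered t (D t)) /\
  forall t D', covered t D' -> mu.-negligible (D' `\` D t).
Proof.
have /choice[D DP] : forall t, exists D, covered t D /\
    forall D', covered t D' -> mu.-negligible (D' `\` D).
  move=> t; have [||F cF|D cD maxD] := @maximal_mod_negligible _ _ _ mu (covered t).
  - by split=> //; exists (fun=> cst point).
  - by move=> D [].
  - exact: covered_bigcup.
  - by exists D.
by exists D; split=> t; [case: (DP t)|move=> D'; case: (DP t) => _; apply].
Qed.

(* Let D t be a largest set, modulo null sets, over which the part of B below the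
   node t is covered by countably many measurable functions. Off a null set, if x
   is not in [D [::]], the nodes t with x not in D t form a tree that splits below
   each of its nodes in the y-coordinate, so that the section of B at x contains a
   perfect set. *)
Section maximal.
Variable D : seq (bool * nat) -> set X.
Hypothesis coveredD : forall t, covered t (D t).
Hypothesis maximalD : forall t D', covered t D' -> mu.-negligible (D' `\` D t).

Let measurableD0 t : measurable (D t). Proof. by case: (coveredD t). Qed.

Let unsplit t : set X := [set x | forall t1 t2, extends t t1 -> extends t t2 ->
  (exists i, [/\ (i < size t1)%N, (i < size t2)%N & bits t1 i != bits t2 i]) ->
  D t1 x \/ D t2 x].

(** Call a node s alive at x if x is not in [D s]. A branch through a dead node is covered by the
    functions of that node. The alive nodes all trace the same y, so one further function [g] covers
    the branches through alive nodes only. *)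
Let covered_unsplit t : covered t (unsplit t).
Proof.
have /choice[f fP] : forall s, exists f : nat -> X -> borel cantor_space,
    (forall i, measurable_fun setT (f i)) /\
    forall x y, D s x -> branch s x y -> exists i, y = f i x.
  by move=> s; have [_ [f mf Df]] := coveredD s; exists f.
pose g (x : X) : borel cantor_space := fun n => `[< exists s,
  [/\ extends t s, (n < size s)%N, bits s n & ~ D s x] >].
have mg : measurable_fun setT g.
  apply: measurable_fun_cantor => n.
  rewrite (_ : mkset _ = [set x | exists s, [/\ extends t s, (n < size s)%N, bits s n & ~ D s x]]).
    apply: measurable_exists => s.
    have [H|nH] := pselect [/\ extends t s, (n < size s)%N & bits s n].
      rewrite (_ : mkset _ = ~` D s); first exact: measurableC.
      by apply/seteqP; split=> x /=; [case|case: H; split].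
    rewrite (_ : mkset _ = set0)// -subset0 => x [? ? ? _]; exact: nH.
  by apply/seteqP; split=> x /asboolP.
apply: (@covered_family _ _ (option (seq (bool * nat) * nat))
  (fun o => if o is Some p then f p.1 p.2 else g)).
- apply: measurable_forall => t1; apply: measurable_forall => t2.
  have [H|nH] := pselect [/\ extends t t1, extends t t2 &
      exists i, [/\ (i < size t1)%N, (i < size t2)%N & bits t1 i != bits t2 i]].
    rewrite (_ : mkset _ = D t1 `|` D t2); first exact: measurableU.
    by apply/seteqP; split=> x /=; [case: H => ? ? ? /(_ _ _ _); exact|].
  rewrite (_ : mkset _ = setT)//; apply/seteqP; split=> // x _ /= ? ? ?.
  by exfalso; apply: nH.
- by move=> [p|//]; case: (fP p.1).
- move=> x y ux [al tya Kx]; pose s n := node y al (maxn n (size t)).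
  have ts n : extends t (s n).
    split; first by rewrite size_mkseq leq_maxr.
    exact: agree_trans tya (agree_le (leq_maxr _ _) (@agree_node y al _)).
  have [[n Dn]|/forallNP nD] := pselect (exists n, D (s n) x).
    have [|i ->] := (fP (s n)).2 x y Dn; last by exists (Some (s n, i)).
    by exists al => //; rewrite size_mkseq; apply: agree_sym; exact: agree_node.
  have sn n : (n < size (s n.+1))%N by rewrite size_mkseq leq_maxl.
  have bn n : bits (s n.+1) n = y n by case: (@agree_node y al _ n (leq_maxl n.+1 (size t))).
  exists None; apply: funext => n; apply/esym/asboolP; case: (boolP (y n)) => yn.
    by exists (s n.+1); split=> //; rewrite bn.
  move=> [s' [ts' ns' bs' nDs']].
  case: (ux s' (s n.+1) ts' (ts n.+1)) => //; last exact: nD.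
  by exists n; split=> //; rewrite bs' bn (negbTE yn).
Qed.

(** Cantor's diagonal argument. For x outside [D [::]] and outside the null sets given by
    maximality, alive nodes are extended so as to leave the k-th point of the section at step k; the
    limit is a point of the section that was not listed. *)
Lemma covered_root_negligible :
  (forall x, countable [set y : borel cantor_space | exists al, forall n, K n y al x]) ->
  mu.-negligible (~` D [::]).
Proof.
move=> ctb.
apply: (@negligibleS _ _ _ _ [set x | exists t,
    ((unsplit t `\` D t) `|` [set x | exists n, (refuted t n `\` D t) x]) x]); last first.
  apply: negligible_exists => t; apply: negligibleU; first exact/maximalD/covered_unsplit.
  by apply: negligible_exists => n; exact/maximalD/covered_refuted.
move=> x nDx; apply: contrapT => /forallNP good.
(* Two alive extensions of t differ at some bit, and one of them differs there from z. *)
have splits t (z : nat -> bool) : exists t', ~ D t x ->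
    [/\ extends t t', ~ D t' x, (size t < size t')%N &
        exists2 j, (j < size t')%N & bits t' j != z j].
  have [Dt|nDt] := pselect (D t x); first by exists [::].
  have /existsNP[t1 /existsNP[t2 /not_implyP[e1 /not_implyP[e2]]]] : ~ unsplit t x.
    by move=> ut; apply: (good t); left.
  move=> /not_implyP[[i [i1 i2 b12]] /not_orP[n1 n2]].
  have ti : (size t <= i)%N.
    rewrite leqNgt; apply/negP => it; move: b12.
    by have [-> _] := e1.2 i it; have [-> _] := e2.2 i it; rewrite eqxx.
  have [b1z|b1z] := eqVneq (bits t1 i) (z i).
    exists t2 => _; split=> //; first exact: leq_ltn_trans i2.
    by exists i => //; rewrite -b1z eq_sym.
  exists t1 => _; split=> //; first exact: leq_ltn_trans i1.
  by exists i.
have [e eP] : exists e : nat -> borel cantor_space,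
    [set y : borel cantor_space | exists al, forall n, K n y al x] `<=` range e.
  have /pcard_leP[g] := ctb x.
  pose e n := xget point [set y : borel cantor_space |
    (exists al, forall n, K n y al x) /\ g y = n].
  exists e => y Yy; exists (g y) => //; rewrite /e.
  case: xgetP => [y' _ [Yy' gyy']|/(_ y)]; last by case.
  by apply: ('inj_g); rewrite ?inE.
have /choice[next nextP] : forall p : seq (bool * nat) * nat, exists t', ~ D p.1 x ->
    [/\ extends p.1 t', ~ D t' x, (size p.1 < size t')%N &
        exists2 j, (j < size t')%N & bits t' j != e p.2 j].
  by move=> p; exact: splits.
pose T := fix T k := if k is k'.+1 then next (T k', k') else [::].
have nDT k : ~ D (T k) x.
  by elim: k => [//|k IH]; case: (nextP (T k, k) IH).
have TS k : [/\ extends (T k) (T k.+1), (size (T k) < size (T k.+1))%N &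
    exists2 j, (j < size (T k.+1))%N & bits (T k.+1) j != e k j].
  by case: (nextP (T k, k) (nDT k)).
have sT k : (k <= size (T k))%N.
  by elim: k => // k IH; case: (TS k) => _ + _; exact: leq_ltn_trans.
have eT k l : (k <= l)%N -> extends (T k) (T l).
  elim: l => [|l IH]; first by rewrite leqn0 => /eqP ->; split.
  rewrite leq_eqVlt => /orP[/eqP ->|]; first by split.
  rewrite ltnS => /IH [kl akl]; have [[ll1 al1] _ _] := TS l.
  split; first exact: leq_trans ll1.
  exact: agree_trans akl (agree_le kl al1).
(* [T i.+1] has length greater than i, so no default entry is read. *)
pose y i := bits (T i.+1) i; pose al i := nums (T i.+1) i.
have Tya k : agree (size (T k)) (bits (T k)) (nums (T k)) y al.
  move=> i iT; rewrite /y /al; case: (leqP k i.+1) => ki.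
    by case: ((eT _ _ ki).2 i iT).
  by have [] := (eT _ _ (ltnW ki)).2 i (sT i.+1) => -> ->.
have [k _ ek] : range e y.
  (* Since [T N] is not refuted, condition n holds for some pair extending it, hence for (y, al) by
     local constancy. *)
  apply: eP; exists al => n; have [N HN] := schemeK.2 n y al.
  have : ~ refuted (T N) n x.
    by move=> rx; apply: (good (T N)); right; exists n; split=> //; exact: nDT.
  move=> /existsNP[y' /existsNP[al' /not_implyP[H /contrapT Kx]]].
  rewrite -(HN y' al')//; apply: agree_le (sT N) _.
  exact: agree_trans (agree_sym (Tya N)) H.
have [_ _ [j jT]] := TS k; rewrite ek.
by have [-> _] := Tya k.+1 j jT; rewrite eqxx.
Qed.

End maximal.

Lemma ae_section_cover :
  (forall x, countable [set y : borel cantor_space | exists al, forall n, K n y al x]) ->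
  exists (f : nat -> X -> borel cantor_space) (N : set X),
    [/\ forall i, measurable_fun setT (f i), mu.-negligible N &
        forall x y, ~ N x -> (exists al, forall n, K n y al x) -> exists i, y = f i x].
Proof.
move=> ctb; have [D [cD maxD]] := maximal_covered.
have [_ [f mf fP]] := cD [::]; exists f, (~` D [::]); split=> //.
  exact: covered_root_negligible.
by move=> x y /contrapT Dx [al Kx]; apply: fP => //; exists al.
Qed.

End lusin_novikov.

Lemma ae_lusin_novikov (R : realType) d (X : measurableType d) (mu : probability X R)
    (B : set (X * borel cantor_space)) :
  measurable B -> (forall x, countable [set y | B (x, y)]) ->
  exists (f : nat -> X -> borel cantor_space) (N : set X),
    [/\ forall i, measurable_fun setT (f i), mu.-negligible N &
        forall x y, ~ N x -> B (x, y) -> exists i, y = f i x].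
Proof.
move=> /measurable_souslin[K sK BK] ctb.
have [|f [N [mf nN fP]]] := ae_section_cover mu sK.
  move=> x; rewrite (_ : mkset _ = [set y | B (x, y)])//.
  by apply/seteqP; split=> y; case: (BK x y).
by exists f, N; split=> // x y nNx /BK; exact: fP.
Qed.

(** * Feldman-Moore almost everywhere *)

Lemma measurable_fun_ifP d d' (T : measurableType d) (T' : measurableType d')
    (P : T -> Prop) (f g : T -> T') :
  measurable [set x | P x] -> measurable_fun setT f -> measurable_fun setT g ->
  measurable_fun setT (fun x => if pselect (P x) then f x else g x).
Proof.
move=> mP mf mg _ A mA; rewrite setTI.
rewrite (_ : _ @^-1` A = ([set x | P x] `&` f @^-1` A) `|` (~` [set x | P x] `&` g @^-1` A)).
  apply: measurableU; apply: measurableI => //; try exact: measurableC.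
    exact: measurable_preimage mf mA.
  exact: measurable_preimage mg mA.
apply/seteqP; split=> x /=; first by case: (pselect (P x)) => ?; [left|right].
by case=> -[]; case: (pselect (P x)).
Qed.

Section involutions.
Context d (X : measurableType d).
Variable (code : X -> borel cantor_space).
Hypotheses (mcode : measurable_fun setT code) (code_inj : injective code).

Lemma measurable_fun_eq (f g : X -> X) :
  measurable_fun setT f -> measurable_fun setT g -> measurable [set x | f x = g x].
Proof.
move=> mf mg; rewrite (_ : mkset _ = [set x | forall n, code (f x) n = code (g x) n]).
  apply: measurable_forall => n; apply: measurable_eqb.
  - exact: measurable_coordinate_fun (measurableT_comp mcode mf).
  - exact: measurable_coordinate_fun (measurableT_comp mcode mg).
apply/seteqP; split=> x /=; first by move=> ->.
by move=> /funext/code_inj.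
Qed.

Variable f : nat -> X -> X.
Hypothesis mf : forall i, measurable_fun setT (f i).

Definition swap_domain i j k (b : bool) : set X :=
  [set x | [/\ f j (f i x) = x, code x k = b & code (f i x) k = ~~ b]].

(** Exchanges x and f i x where f j leads back and bit k tells the two points apart. That bit makes
    the domain of f i disjoint from its image, which is the domain of f j. *)
Definition swap i j k b (x : X) : X :=
  if pselect (swap_domain i j k b x) then f i x else
  if pselect (swap_domain j i k (~~ b) x) then f j x else x.

Lemma swap_domain_f i j k b x :
  swap_domain i j k b x -> swap_domain j i k (~~ b) (f i x).
Proof. by case=> e xb fxb; split; rewrite ?e ?negbK. Qed.

Lemma swap_domain_disj i j k b x :
  swap_domain i j k b x -> ~ swap_domain j i k (~~ b) x.
Proof. by move=> [_ xb _] [_]; rewrite xb; case: b {xb}. Qed.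

Lemma swapK i j k b : involutive (swap i j k b).
Proof.
move=> x; rewrite {2}/swap; case: (pselect (swap_domain i j k b x)) => [Dx|nDx] /=.
  have Dfx := swap_domain_f Dx; rewrite /swap.
  case: (pselect (swap_domain i j k b (f i x))) => [/swap_domain_disj//|_] /=.
  by case: (pselect _) => //= _; case: Dx.
case: (pselect (swap_domain j i k (~~ b) x)) => [Dx|nDx'] /=.
  have := swap_domain_f Dx; rewrite negbK => Dfx; rewrite /swap.
  by case: (pselect _) => //= _; case: Dx.
rewrite /swap; case: (pselect _) => [//|_] /=.
by case: (pselect _).
Qed.

Lemma measurable_swap_domain i j k b : measurable (swap_domain i j k b).
Proof.
rewrite (_ : swap_domain i j k b = [set x | (f j \o f i) x = id x] `&`
   ([set x | code x k = (fun=> b) x] `&` [set x | (code \o f i) x k = (fun=> ~~ b) x])).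
  apply: measurableI; first by apply: measurable_fun_eq => //; exact: measurableT_comp.
  by apply: measurableI; apply: measurable_eqb;
    try exact: measurable_const_set; apply: measurable_coordinate_fun => //;
    exact: measurableT_comp.
by apply/seteqP; split=> x; [case|case=> ? [? ?]; split].
Qed.

Lemma measurable_swap i j k b : measurable_fun setT (swap i j k b).
Proof.
apply: measurable_fun_ifP => //; first exact: measurable_swap_domain.
by apply: measurable_fun_ifP => //; exact: measurable_swap_domain.
Qed.

Lemma swap_cover i j x y : x <> y -> f i x = y -> f j y = x ->
  exists k b, swap i j k b x = y.
Proof.
move=> xy fx fy; have [k kP] : exists k, code x k != code y k.
  apply: contrapT => /forallNP H; apply: xy; apply: code_inj; apply: funext => k.
  by apply/eqP; rewrite -[_ == _]negbK; apply/negP/H.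
exists k, (code x k); rewrite /swap; case: (pselect _) => //= -[].
by split; rewrite ?fx//; case: (code x k) (code y k) kP => -[].
Qed.

End involutions.

Lemma ae_involutions (R : realType) d (X : measurableType d) (mu : probability X R)
    (F : X -> X -> Prop) : countable_borel_equivalence R F ->
  exists (sig : nat -> X -> X) (N : set X),
    [/\ forall m, measurable_fun setT (sig m), forall m, involutive (sig m),
        forall m x, F x (sig m x), mu.-negligible N &
        forall x y, ~ N x -> ~ N y -> F x y -> x = y \/ exists m, sig m x = y].
Proof.
move=> [sX [Frefl Fsym Ftrans] mF ctF].
have [code [decode [mcode mdecode codeK]]] := standard_borel_retract sX.
have code_inj := can_inj codeK.
(* The relation F with its second argument replaced by its code; the equation picks out the points
   that are codes. *)
pose B : set (X * borel cantor_space) :=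
  [set p | (forall n, code (decode p.2) n = p.2 n) /\ F p.1 (decode p.2)].
have mdec : measurable_fun setT (decode \o snd : X * borel cantor_space -> X).
  exact: measurableT_comp.
have mB : measurable B.
  apply: measurableI.
    apply: measurable_forall => n; apply: measurable_eqb.
      apply: (@measurable_coordinate_fun _ _ (code \o (decode \o snd))).
      exact: measurableT_comp.
    exact: (@measurable_coordinate_fun _ _ snd).
  apply: (measurable_preimage (f := fun p : X * borel cantor_space => (p.1, decode p.2)) _ mF).
  exact: measurable_fun_pair.
have ctB x : countable [set z | B (x, z)].
  apply: (sub_countable (B := code @` [set y | F x y])).
    by apply: subset_card_le => z [/= zE Fz]; exists (decode z) => //; exact: funext.
  exact: sub_countable (card_image_le _ _) (ctF x).
have [g [N [mg nN gP]]] := ae_lusin_novikov mu mB ctB.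
(* Falling back to x keeps f i inside the F-class. *)
pose f i x := if pselect (F x (decode (g i x))) then decode (g i x) else x.
have mf i : measurable_fun setT (f i).
  have mdg : measurable_fun setT (decode \o g i) by exact: measurableT_comp.
  apply: measurable_fun_ifP => //.
  apply: (measurable_preimage (f := fun x => (x, decode (g i x))) _ mF).
  exact: measurable_fun_pair.
have Ff i x : F x (f i x) by rewrite /f; case: (pselect _).
have fP x y : ~ N x -> F x y -> exists i, f i x = y.
  move=> nNx Fxy; have [|i ci] := gP x (code y) nNx.
    by split=> /=; rewrite codeK.
  by exists i; rewrite /f -ci codeK; case: (pselect _).
exists (fun n => if unpickle n is Some (i, j, k, b) then swap code f i j k b else id), N.
split=> //.
- by move=> n; case: (unpickle n) => [[[[i j] k] b]|//]; exact: measurable_swap.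
- by move=> n; case: (unpickle n) => [[[[i j] k] b]|//]; exact: swapK.
- move=> n x; case: (unpickle n) => [[[[i j] k] b]|//=]; rewrite /swap.
  case: (pselect _) => [?|_] /=; first exact: Ff.
  by case: (pselect _) => [?|_] /=; [exact: Ff|exact: Frefl].
- move=> x y nNx nNy Fxy; have [->|xy] := pselect (x = y); [by left|right].
  have [i fi] := fP x y nNx Fxy; have [j fj] := fP y x nNy (Fsym _ _ Fxy).
  have [k [b sxy]] := swap_cover code_inj xy fi fj.
  by exists (pickle (i, j, k, b)); rewrite pickleK.
Qed.

(** * Separation by parities *)

Lemma injective_unbounded (f : nat -> nat) s : injective f -> exists r, (s <= f r)%N.
Proof.
move=> f_inj; apply: contrapT => /forallNP H.
have fs (r : 'I_s.+1) : (f r < s)%N by rewrite ltnNge; apply/negP/H.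
pose g (r : 'I_s.+1) := Ordinal (fs r).
have /leq_card : injective g by move=> a b /(congr1 val)/f_inj/val_inj.
by rewrite !card_ord ltnn.
Qed.

(** The linear functionals of finite support over the field with two elements. *)
Definition parity (s : seq nat) (z : nat -> bool) :=
  foldr (fun k b => z k (+) b) false s.

Lemma parity_addb s (z z' : nat -> bool) :
  parity s (fun k => z k (+) z' k) = parity s z (+) parity s z'.
Proof. by elim: s => //= k s ->; rewrite addbACA. Qed.

Section separation.
Context (R : realType) d (X : measurableType d) (mu : probability X R).
Local Open Scope ring_scope.

Lemma measurable_parity s (z : X -> nat -> bool) :
  (forall k, measurable [set x | z x k]) -> measurable [set x | parity s (z x)].
Proof.
move=> mz; elim: s => [|k s IH] /=; first exact: measurable_const_set.
rewrite (_ : mkset _ = ~` [set x | z x k = parity s (z x)]).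
  by apply: measurableC; exact: measurable_eqb.
apply/seteqP; split=> x /=; first by case: (z x k); case: parity.
by case: (z x k); case: parity.
Qed.

(* A nonzero vector is decided by its last nonzero coordinate: once the bits of
   [s] below it are fixed, one of the two choices there separates half. *)
Lemma parity_half (z : X -> nat -> bool) (L : nat) (Q : set X) :
  (forall k, measurable [set x | z x k]) -> measurable Q ->
  exists s, rprob mu (Q `&` [set x | exists k, (k < L)%N /\ z x k]) <=
    2 * rprob mu (Q `&` [set x | parity s (z x)]).
Proof.
move=> mz; elim: L Q => [|L IH] Q mQ.
  exists [::]; rewrite (_ : [set x | _] = set0) ?setI0; last by rewrite -subset0 => x [k []].
  by rewrite {1}/rprob measure0/= mulr_ge0// rprob_ge0.
have mex l : measurable [set x | exists k, (k < l)%N /\ z x k].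
  by apply: measurable_exists => k; apply: measurableI; [exact: measurable_const_set|exact: mz].
have mpar s : measurable [set x | parity s (z x)] by exact: measurable_parity.
have mQL : measurable (Q `\` [set x | z x L]) by exact: measurableD.
have [s sP] := IH _ mQL.
have mA := measurableI _ _ mQ (mex L.+1).
have mQ1 : measurable (Q `&` [set x | z x L]) by exact: measurableI.
have split_par t : rprob mu (Q `&` [set x | parity t (z x)]) =
    rprob mu (Q `&` [set x | z x L] `&` [set x | parity t (z x)]) +
    rprob mu ((Q `\` [set x | z x L]) `&` [set x | parity t (z x)]).
  rewrite (rprob_setID mu (measurableI _ _ mQ (mpar t)) (mz L)).
  by congr (rprob mu _ + rprob mu _); apply/seteqP; split=> x; case=> -[].
have -> : rprob mu (Q `&` [set x | exists k, (k < L.+1)%N /\ z x k]) =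
    rprob mu (Q `&` [set x | z x L]) +
    rprob mu ((Q `\` [set x | z x L]) `&` [set x | exists k, (k < L)%N /\ z x k]).
  rewrite (rprob_setID mu mA (mz L)); congr (rprob mu _ + rprob mu _).
    apply/seteqP; split=> x; first by case=> -[? _] ?.
    by case=> ? zL; split=> //; split=> //; exists L.
  apply/seteqP; split=> x.
    move=> [[Qx [k [kL zk]]] nzL]; split=> //; exists k; split=> //.
    by move: kL; rewrite ltnS leq_eqVlt => /orP[/eqP kE|//]; case: nzL; rewrite /= -kE.
  by move=> [[Qx nzL] [k [kL zk]]]; split=> //; split=> //; exists k; split=> //; exact: ltnW.
have QE := rprob_setID mu mQ1 (mpar s).
(* If s detects less than half of the part where bit L is set, adding L to s complements the parity
   exactly on that part. *)
have [le|gt] := leP (rprob mu (Q `&` [set x | z x L]))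
    (2 * rprob mu (Q `&` [set x | z x L] `&` [set x | parity s (z x)])).
  by exists s; rewrite split_par; lra.
exists (L :: s); rewrite split_par.
have -> : Q `&` [set x | z x L] `&` [set x | parity (L :: s) (z x)] =
    (Q `&` [set x | z x L]) `\` [set x | parity s (z x)].
  apply/seteqP; split=> x [[Qx zL]] /=; first by rewrite zL; split=> //; exact/negP.
  by move=> /negP ?; rewrite zL.
have -> : (Q `\` [set x | z x L]) `&` [set x | parity (L :: s) (z x)] =
    (Q `\` [set x | z x L]) `&` [set x | parity s (z x)].
  by apply/seteqP; split=> x [[Qx /negP/negbTE /= nzL]] /=; rewrite nzL.
lra.
Qed.

End separation.

(** * The diagonalisation *)

Section diagonal.
Context (R : realType) d (X : measurableType d) (mu : probability X R).
Variable (code : X -> borel cantor_space).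
Hypotheses (mcode : measurable_fun setT code) (code_inj : injective code).
Variables (m : nat -> nat -> nat) (p : nat -> nat -> X -> X).
Hypothesis mp : forall i n, measurable_fun setT (p i n).
Implicit Types (c : seq (set X)) (A : set X) (i n k : nat).

Let good c := forall n, measurable (nth set0 c n).

(** The list c is an initial segment of the sets C_n. It already refutes, for every y, that the i-th
    permutation takes the image of x to that of y. *)
Definition killed c i x := forall y, exists n, [/\ (n < size c)%N, (m i n < size c)%N &
  ~ (nth set0 c n y <-> nth set0 c (m i n) (p i n x))].

Definition extension c (v : nat -> set X) L := c ++ mkseq (fun k => v (size c + k)%N) L.

Let size_extension c v L : size (extension c v L) = (size c + L)%N.
Proof. by rewrite size_cat size_mkseq. Qed.

Let nth_extension_old c v L n : (n < size c)%N ->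
  nth set0 (extension c v L) n = nth set0 c n.
Proof. by move=> nc; rewrite nth_cat nc. Qed.

Let nth_extension_new c v L n : (size c <= n < size c + L)%N ->
  nth set0 (extension c v L) n = v n.
Proof.
move=> /andP[cn nL]; rewrite nth_cat ltnNge cn /= nth_mkseq; first by rewrite subnKC.
by rewrite ltn_subLR.
Qed.

Let good_extension c v L : good c -> (forall n, measurable (v n)) -> good (extension c v L).
Proof.
move=> gc mv n; case: (ltnP n (size c)) => cn; first by rewrite nth_extension_old.
case: (ltnP n (size c + L)) => nL; first by rewrite nth_extension_new ?cn.
by rewrite nth_default ?size_extension.
Qed.

(** * Killing a permutation on a quarter of the remaining points *)

Definition shifting i := forall N, exists n, (N <= n)%N /\ m i n <> n.
Definition wandering i x := forall N, exists n, (N <= n)%N /\ p i n x <> p i N x.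
Definition bad i : set X := [set x | shifting i \/ wandering i x].

Let measurable_mp_code i n k : measurable [set x | code (p i n x) k].
Proof. exact: measurable_coordinate_fun (measurableT_comp mcode (mp i n)). Qed.

Let measurable_p_preimage i n A : measurable A -> measurable [set x | A (p i n x)].
Proof. by move=> mA; exact: measurable_preimage (mp i n) mA. Qed.

Let measurable_coded k : measurable [set y | code y k].
Proof. exact: measurable_coordinate_fun mcode. Qed.

Lemma measurable_bad i : measurable (bad i).
Proof.
apply: measurableU; first exact: measurable_const_set.
apply: measurable_forall => N; apply: measurable_exists => n.
apply: measurableI; first exact: measurable_const_set.
exact: measurableC (measurable_fun_eq mcode code_inj (mp i n) (mp i N)).
Qed.

(** Take a new index n moved by m i. If m i n is new too, an empty C_n and a full C_(m i n) kill all
    of A. Otherwise C_(m i n) is fixed, and C_n is chosen full or empty so as to disagree with it on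
    at least half of A. *)
Lemma kill_shifting c i A : good c -> measurable A -> shifting i ->
  exists v L A', [/\ good (extension c v L), measurable A', A' `<=` A,
    (rprob mu A' <= 3 / 4 * rprob mu A)%R &
    forall x, A x -> ~ A' x -> killed (extension c v L) i x].
Proof.
move=> gc mA /(_ (size c))[n [cn mn]].
case: (ltnP (m i n) (size c)) => [mc|cm]; last first.
  pose v k : set X := if k == m i n then setT else set0.
  exists v, (maxn n (m i n)).+1, set0.
  split=> //.
  - by apply: good_extension => // k; rewrite /v; case: ifP.
  - by rewrite {1}/rprob measure0 /= mulr_ge0 ?rprob_ge0//; lra.
  - move=> x Ax _ y; exists n; rewrite size_extension; split; [lia|lia|].
    rewrite !nth_extension_new; [|lia|lia].
    by rewrite /v eqxx; case: eqP => [e|_]; [case: mn|move=> [_]; apply].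
pose h := [set x | nth set0 c (m i n) (p i n x)].
have mh : measurable h by exact: measurable_p_preimage.
pose V (b : bool) : set X := if b then setT else set0.
have step b : (rprob mu (if b then A `&` h else A `\` h) <= 3 / 4 * rprob mu A)%R ->
    exists v L A', [/\ good (extension c v L), measurable A', A' `<=` A,
      (rprob mu A' <= 3 / 4 * rprob mu A)%R &
      forall x, A x -> ~ A' x -> killed (extension c v L) i x].
  move=> le; exists (fun=> V b), (n - size c).+1, (if b then A `&` h else A `\` h).
  split=> //.
  - by apply: good_extension => // k; rewrite /V; case: b {le}.
  - by case: b {le}; [exact: measurableI|exact: measurableD].
  - by case: b {le}; [exact: subIsetl|exact: subDsetl].
  - move=> x Ax nx y; exists n; rewrite size_extension; split; [lia|lia|].
    rewrite nth_extension_new; last lia.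
    rewrite nth_extension_old// => -[H1 H2]; case: b nx le H1 H2 => /= nx _ H1 H2.
      by apply: nx; split=> //; exact: H1.
    by apply: nx; split=> // /H2.
have E := rprob_setID mu mA mh; have A0 := rprob_ge0 mu A.
case: (leP (rprob mu (A `&` h)) (rprob mu A / 2)%R) => le.
  by apply: (step true); lra.
by apply: (step false); lra.
Qed.

(** On a block of indices n with m i n = n the same set V is used, so survival forces V to contain
    all or none of the points p i n x of the block. A long block sees two distinct points for half
    of A, and some V separates them for half of these, which leaves 3/4. *)
Lemma kill_wandering c i A : good c -> measurable A -> ~ shifting i ->
  A `<=` wandering i ->
  exists v L A', [/\ good (extension c v L), measurable A', A' `<=` A,
    (rprob mu A' <= 3 / 4 * rprob mu A)%R &
    forall x, A x -> ~ A' x -> killed (extension c v L) i x].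
Proof.
move=> gc mA /existsNP[N0 /forallNP mN0] wA.
have {}mN0 n : (N0 <= n)%N -> m i n = n.
  by move=> nN; apply: contrapT => mn; apply: (mN0 n).
pose N := maxn N0 (size c).
have [A0|A_gt0] := eqVneq (rprob mu A) 0%R.
  exists (fun=> set0), 0%N, A; split=> //; first exact: good_extension.
  by rewrite A0 mulr0.
pose differ j n x := exists k, (k < j)%N /\ code (p i (N + n) x) k <> code (p i N x) k.
have mdiffer j n : measurable [set x | differ j n x].
  apply: measurable_exists => k; apply: measurableI; first exact: measurable_const_set.
  exact: (measurableC (measurable_eqb (measurable_mp_code _ _ _) (measurable_mp_code _ _ _))).
(* Points for which j indices and j bits show no difference; by wandering these sets decrease to the
   empty set. *)
pose F j := A `\` [set x | exists n, (n < j)%N /\ differ j n x].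
have mF j : measurable (F j).
  apply: measurableD => //; apply: measurable_exists => n.
  by apply: measurableI; [exact: measurable_const_set|exact: mdiffer].
have [|||j Fj] := @rprob_bigcap_lt _ _ _ mu F (rprob mu A / 2)%R mF.
- move=> j x [Ax H]; split=> // -[n [nj [k [kj dk]]]]; apply: H.
  by exists n; split; [lia|exists k; split=> //; lia].
- rewrite -subset0 => x Fx; have [Ax _] := Fx 0%N I.
  have [n [Nn]] := wA x Ax N; apply; apply: code_inj; apply: funext => k.
  apply: contrapT => dk; have [_] := Fx (maxn (n - N).+1 k.+1) I; apply.
  exists (n - N)%N; split; first lia.
  by exists k; split; [lia|rewrite subnKC].
- by rewrite divr_gt0// lt_neqAle eq_sym A_gt0 rprob_ge0.
pose t x := first_index (fun n => `[< differ j n x >]).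
(* The difference vector of the two points to be separated, nonzero below j on [B]. *)
pose z x k := code (p i N x) k (+) code (p i (N + t x) x) k.
have mz k : measurable [set x | z x k].
  rewrite (_ : mkset _ = [set x | exists n, t x = n /\
      code (p i (N + n) x) k <> code (p i N x) k]); last first.
    apply/seteqP; split=> x /=.
      by move=> zx; exists (t x); split=> // e; move: zx; rewrite /z e addbb.
    by move=> [n [<-]]; rewrite /z; case: (code _ k); case: (code _ k).
  apply: measurable_exists => n; apply: measurableI.
    apply: (@measurable_first_index _ _ (fun x n => `[< differ j n x >]) (fun a => a = n)) => l.
    rewrite (_ : mkset _ = [set x | differ j l x])//.
    by apply/seteqP; split=> x /asboolP.
  exact: (measurableC (measurable_eqb (measurable_mp_code _ _ _) (measurable_mp_code _ _ _))).
pose B := A `&` [set x | exists n, (n < j)%N /\ differ j n x].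
have mB : measurable B.
  apply: measurableI => //; apply: measurable_exists => n.
  by apply: measurableI; [exact: measurable_const_set|exact: mdiffer].
have [s sP] := parity_half mu j mz mB.
have tP x : B x -> (t x < j)%N /\ differ j (t x) x.
  move=> [_ [n [nj dn]]]; have /first_index_eq [[tx tmin]|[_ /(_ n)]] := erefl (t x); last first.
    by case; apply/asboolP.
  split; last exact/asboolP.
  apply: leq_ltn_trans nj; rewrite leqNgt; apply/negP => /tmin; apply; exact/asboolP.
have BE : B `&` [set x | exists k, (k < j)%N /\ z x k] = B.
  apply/seteqP; split=> x; first by case.
  move=> Bx; split=> //; have [_ [k [kj dk]]] := tP x Bx; exists k; split=> //.
  by move: dk; rewrite /z; case: (code _ k); case: (code _ k).
have AB : A `\` F j = B.
  apply/seteqP; split=> x [Ax]; last by move=> H; split=> // -[_].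
  by move=> H; split=> //; apply: contrapT => nH; apply: H.
pose V := [set y | parity s (code y)].
have mV : measurable V by exact: measurable_parity.
have mP : measurable [set x | parity s (z x)] by exact: measurable_parity.
(* Empty sets fill the positions up to N; the block is N, ..., N + j - 1. *)
exists (fun n => if (n < N)%N then set0 else V), (N + j - size c)%N,
  (A `\` (B `&` [set x | parity s (z x)])).
have cN : (size c <= N)%N by rewrite leq_maxr.
split.
- by apply: good_extension => // n; case: ifP.
- by apply: measurableD => //; exact: measurableI.
- exact: subDsetl.
- have := rprob_setID mu mA (measurableI _ _ mB mP).
  have -> : A `&` (B `&` [set x | parity s (z x)]) = B `&` [set x | parity s (z x)].
    by apply/seteqP; split=> x; [case|case=> -[]].
  have := rprob_setID mu mA (mF j); rewrite AB.
  have -> : A `&` F j = F j by apply/seteqP; split=> x; [case|case].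
  by move: sP Fj; rewrite BE; lra.
- move=> x Ax nx; have [Bx px] : (B `&` [set x | parity s (z x)]) x.
    by apply: contrapT => H; apply: nx.
  have [tj _] := tP x Bx.
  have : ~ (V (p i N x) <-> V (p i (N + t x) x)).
    move: px; rewrite /z /V /= parity_addb.
    case: (parity s (code _)); case: (parity s (code _)) => // _ [H1 H2].
      by have := H1 isT.
    by have := H2 isT.
  move=> nV y; apply: contrapT => /forallNP H; apply: nV.
  have VE n : (N <= n < N + j)%N -> V y <-> V (p i n x).
    move=> /andP[Nn nj]; have := H n; rewrite size_extension mN0; last lia.
    rewrite !nth_extension_new ?mN0; try lia.
    rewrite [(n < N)%N]ltnNge Nn /= => H'; apply: contrapT => nV; apply: H'.
    by split=> //; lia.
  have := VE N ltac:(lia); have := VE (N + t x)%N ltac:(lia); tauto.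
Qed.

Lemma kill c i A : good c -> measurable A -> A `<=` bad i ->
  exists v L A', [/\ good (extension c v L), measurable A', A' `<=` A,
    (rprob mu A' <= 3 / 4 * rprob mu A)%R &
    forall x, A x -> ~ A' x -> killed (extension c v L) i x].
Proof.
move=> gc mA bA; have [si|nsi] := pselect (shifting i); first exact: kill_shifting.
by apply: kill_wandering => // x /bA[].
Qed.

Let killed_extension c v L i x : killed c i x -> killed (extension c v L) i x.
Proof.
move=> kc y; have [n [nc mc H]] := kc y; exists n; rewrite size_extension.
by split; [lia|lia|rewrite !nth_extension_old].
Qed.

Let coding c k := rcons c [set y | code y k].

Let good_coding c k : good c -> good (coding c k).
Proof.
by move=> gc n; rewrite nth_rcons; case: ltnP => // _; case: eqP.
Qed.

Let killed_coding c k i x : killed c i x -> killed (coding c k) i x.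
Proof.
move=> kc y; have [n [nc mc H]] := kc y; exists n; rewrite size_rcons.
by split; [lia|lia|rewrite !nth_rcons nc mc].
Qed.

(** A state is a list of sets with, for each i, the bad points not yet killed. A stage for (i, k)
    appends the k-th coordinate set and then kills for i. The invariants are premises, so that
    choice yields a total step function. *)
Lemma diagonal_step (s : seq (set X) * (nat -> set X)) (j : nat * nat) :
  exists s' : seq (set X) * (nat -> set X),
  good s.1 -> (forall i, measurable (s.2 i)) -> (forall i, s.2 i `<=` bad i) ->
  [/\ good s'.1, (forall i, measurable (s'.2 i)) , (forall i, s'.2 i `<=` s.2 i) &
   [/\ (rprob mu (s'.2 j.1) <= 3 / 4 * rprob mu (s.2 j.1))%R,
    (size s.1 < size s'.1)%N,
    forall n, (n < size s.1)%N -> nth set0 s'.1 n = nth set0 s.1 n,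
    nth set0 s'.1 (size s.1) = [set y | code y j.2] &
    forall i x, (killed s.1 i x \/ (s.2 i x /\ ~ s'.2 i x)) -> killed s'.1 i x]].
Proof.
have [gc|] := pselect (good s.1); last by exists s.
have [mA|] := pselect (forall i, measurable (s.2 i)); last by exists s.
have [bA|] := pselect (forall i, s.2 i `<=` bad i); last by exists s.
have [v [L [A' [gA' mA' sA' lA' kA']]]] := kill (good_coding j.2 gc) (mA j.1) (bA j.1).
exists (extension (coding s.1 j.2) v L, fun i => if i == j.1 then A' else s.2 i) => _ _ _.
split=> //=.
- by move=> i; case: eqP.
- by move=> i; case: eqP => [->|_] //; exact: subset_refl.
split.
- by rewrite eqxx.
- by rewrite size_extension size_rcons; lia.
- move=> n ns; rewrite nth_extension_old ?size_rcons; last lia.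
  by rewrite nth_rcons ns.
- by rewrite nth_extension_old ?size_rcons// nth_rcons ltnn eqxx.
- move=> i x [/killed_coding/killed_extension//|[sx]].
  by case: eqP => // e; rewrite e in sx *; exact: kA'.
Qed.

Lemma diagonalisation : exists (C : nat -> set X) (N : set X),
  [/\ forall n, measurable (C n), mu.-negligible N &
    forall x i y, ~ N x -> (forall n, C n y <-> C (m i n) (p i n x)) ->
      exists n, y = p i n x].
Proof.
have /choice[next nextP] : forall q, exists s', _ := fun q => diagonal_step q.1 q.2.
(* The third component is dropped, so each pair is the task of infinitely many stages. *)
pose task s : nat * nat :=
  if (unpickle s : option (nat * nat * nat)) is Some (i, k, _) then (i, k) else (0, 0)%N.
pose st := fix st s := if s is s'.+1 then next (st s', task s') else ([::], bad).
have inv s : [/\ good (st s).1, forall i, measurable ((st s).2 i) &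
    forall i, (st s).2 i `<=` bad i].
  elim: s => [|s [gs ms bs]].
    split=> [n|i|i] /=; [by rewrite nth_nil|exact: measurable_bad|exact: subset_refl].
  have [? ? ss _] := nextP (st s, task s) gs ms bs; split=> // i.
  exact: subset_trans (ss i) (bs i).
have stS s := let: And3 gs ms bs := inv s in nextP (st s, task s) gs ms bs.
have size_st s : (s <= size (st s).1)%N.
  by elim: s => // s IH; have [_ _ _ [_ + _ _ _]] := stS s; exact: leq_ltn_trans.
have nth_st s s' n : (n < size (st s).1)%N -> (s <= s')%N ->
    nth set0 (st s').1 n = nth set0 (st s).1 n /\ (n < size (st s').1)%N.
  move=> ns; elim: s' => [|s' IH]; first by rewrite leqn0 => /eqP <-.
  rewrite leq_eqVlt => /orP[/eqP <-//|]; rewrite ltnS => /IH [IH1 IH2].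
  have [_ _ _ [_ lt_s nth_s _ _]] := stS s'.
  by rewrite /= nth_s//; split=> //; exact: ltn_trans lt_s.
(* After n + 1 stages the list has more than n entries, and entries never change. *)
pose C n := nth set0 (st n.+1).1 n.
have CE s n : (n < size (st s).1)%N -> C n = nth set0 (st s).1 n.
  move=> ns; rewrite /C; case: (leqP s n.+1) => sn.
    by have [-> _] := nth_st _ _ _ ns sn.
  by have [-> _] := nth_st n.+1 s n (size_st n.+1) (ltnW sn).
have killedP s i x : bad i x -> ~ (st s).2 i x -> killed (st s).1 i x.
  elim: s => [//|s IH] bx nx; have [_ _ _ [_ _ _ _]] := stS s; apply.
  by have [sx|nsx] := pselect ((st s).2 i x); [right|left; exact: IH].
pose A i := \bigcap_s (st s).2 i.
have mA i : measurable (A i).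
  by apply: bigcapT_measurable => s; have [_ + _] := inv s; exact.
have visit i k s : exists2 s', (s <= s')%N & task s' = (i, k).
  have [|r sr] := @injective_unbounded (fun r : nat => pickle (i, k, r)) s.
    by move=> r r' /(pcan_inj pickleK)[].
  by exists (pickle (i, k, r)) => //; rewrite /task pickleK.
have decay i e : exists s, (rprob mu ((st s).2 i) <= (3 / 4) ^+ e)%R.
  elim: e => [|e [s IH]].
    by exists 0%N; rewrite expr0 rprob_le1//; have [_ + _] := inv 0%N; exact.
  have [s' ss' ts'] := visit i 0%N s.
  have le_s : (rprob mu ((st s').2 i) <= rprob mu ((st s).2 i))%R.
    elim: s' ss' {ts'} => [|s' IHs]; first by rewrite leqn0 => /eqP ->.
    rewrite leq_eqVlt => /orP[/eqP ->//|]; rewrite ltnS => /IHs; apply: le_trans.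
    have [_ ms' ss _] := stS s'; have [_ ms _] := inv s'.
    by apply: le_rprob => //; exact: ss.
  exists s'.+1; have [_ _ _ [+ _ _ _ _]] := stS s'; rewrite /= ts' exprS /=.
  by move: IH le_s; move: ((3 / 4) ^+ e)%R => a; lra.
(* Each visit to i multiplies the measure of the survivors by at most 3/4. *)
have nA : mu.-negligible [set x | exists i, A i x].
  apply: negligible_exists => i; apply/negligible_rprob => //.
  apply/eqP; rewrite eq_le rprob_ge0 andbT leNgt; apply/negP => gt0.
  have : ((fun e => (3 / 4 : R) ^+ e) @ \oo --> (0 : R))%R.
    by apply: cvg_expr; rewrite ger0_norm; lra.
  move=> /cvgrPdist_lt/(_ _ gt0)[e _ /(_ e (leqnn e)) /=].
  have q0 : (0 <= (3 / 4 : R) ^+ e)%R by apply: exprn_ge0; lra.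
  rewrite sub0r normrN ger0_norm// => lt_e.
  have [s le_s] := decay i e.
  have : (rprob mu (A i) <= rprob mu ((st s).2 i))%R.
    by apply: le_rprob => //; [have [_ + _] := inv s; exact|exact: bigcap_inf].
  by rewrite leNgt (le_lt_trans le_s lt_e).
exists C, [set x | exists i, A i x]; split=> //.
- by move=> n; have [+ _ _] := inv n.+1; exact.
- move=> x i y nAx Cy.
  have nbx : ~ bad i x.
    move=> bx; have /existsNP[s /not_implyP[_ nx]] : ~ A i x by move=> Ax; apply: nAx; exists i.
    have [n [ns ms]] := killedP s i x bx nx y; apply.
    by rewrite -!CE//; exact: Cy.
  have [ns /existsNP[N2 /forallNP wx]] : ~ shifting i /\ ~ wandering i x by exact/not_orP.
  have /existsNP[N1 /forallNP sx] := ns.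
  exists N2; apply: code_inj; apply: funext => k.
  (* A stage past the stabilisation of m i and of p i n x appends coordinate k; the equation at that
     position compares bit k of y with that of the limit point. *)
  have [s Ns ts] := visit 0%N k (maxn N1 N2).
  have [_ _ _ [_ lt_s _ cs _]] := stS s.
  pose n := size (st s).1; have nN : (maxn N1 N2 <= n)%N := leq_trans Ns (size_st s).
  have CnE : C n = [set y | code y k] by rewrite (CE s.+1) // /= cs ts.
  have mn : m i n = n by apply: contrapT => mn; apply: (sx n); split=> //; lia.
  have pn : p i n x = p i N2 x by apply: contrapT => pn; apply: (wx n); split=> //; lia.
  have := Cy n; rewrite mn CnE pn /=.
  by case: (code y k); case: (code _ k) => // -[H1 H2]; [case: (H1 isT)|case: (H2 isT)].
Qed.

End diagonal.

(** * The reduction *)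

Lemma rec_iso_measure_universal (R : realType) : measure_universal R rec_iso.
Proof.
move=> d X mu F cF; have [sX eqF _ _] := cF.
have [code [_ [mcode _ /can_inj code_inj]]] := standard_borel_retract sX.
have [sig [N1 [msig sigK Fsig nN1 sigP]]] := ae_involutions mu cF.
have [h hP] := computable_bij_enum.
have mfollow w : measurable_fun setT (follow sig w).
  rewrite /follow; elim/last_ind: (word w) => [|s k IH]; first exact: measurable_id.
  under eq_fun do rewrite foldl_rcons.
  exact: measurableT_comp.
have Ffollow w x : F x (follow sig w x).
  rewrite /follow; elim/last_ind: (word w) => [|s k IH]; first by reflexivity.
  by rewrite foldl_rcons; transitivity (foldl (fun y m => sig m y) x s).
(* Halving turns the marker 2n + 1 into n. *)
pose column w := (base w)./2.
(* The index and the point that f x consults at the image under h i of the empty word with marker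
   n. *)
pose m i n := column (h i n.*2.+1); pose p i n := follow sig (h i n.*2.+1).
have [C [N2 [mC nN2 CP]]] := diagonalisation mu mcode code_inj m (p := p)
  (fun i n => mfollow _).
pose f (x : X) : borel cantor_space := fun w => `[< C (column w) (follow sig w x) >].
have f_flip k x : (fun n => f x (flip k n)) = f (sig k x).
  apply: funext => n; rewrite /f /column base_flip follow_flip//.
have f_column x n : f x n.*2.+1 = `[< C n x >].
  have o : odd n.*2.+1 by rewrite /= odd_double.
  have e : n.*2.+1./2 = n by lia.
  by rewrite /f /column follow_odd// (word_odd o).2 e.
have [N [mN N0 NN]] := negligibleU nN1 nN2.
exists (~` N); split; [exact: measurableC|by rewrite setCK|].
exists f; split.
  apply: measurable_funTS; apply: measurable_fun_cantor => w.
  rewrite (_ : mkset _ = follow sig w @^-1` C (column w)).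
    exact: measurable_preimage (mfollow w) (mC _).
  by apply/seteqP; split=> x /asboolP.
move=> x y Nx Ny; split=> [Fxy|[g gxy]].
  have [||->|[k <-]] := sigP x y _ _ Fxy.
  - by move=> N1x; apply: Nx; apply: NN; left.
  - by move=> N1y; apply: Ny; apply: NN; left.
  - have [re _ _] := rec_iso_equivalence; exact: re.
  - by exists (flip_bij k); rewrite -f_flip.
have [i gi] := hP g.
have [||n ->] := CP x i y; last exact: Ffollow.
  by move=> N2x; apply: Nx; apply: NN; right.
(* Only the coordinates 2n + 1 are compared: there f y gives the bit of C_n at y itself. *)
move=> n; have := congr1 (fun z : nat -> bool => z n.*2.+1) gxy.
rewrite /perm_act f_column gi /f -/(m i n) -/(p i n) => e.
by split=> /asboolP H; apply/asboolP; [rewrite e|rewrite -e].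
Qed.

Theorem theorem1p8 (R : realType) :
  countable_borel_equivalence R rec_iso /\ measure_universal R rec_iso.
Proof. by split; [exact: rec_iso_countable_borel|exact: rec_iso_measure_universal]. Qed.
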